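(* For every $\epsilon>0$ there exists an integer $g_\epsilon<\infty$ such that $4\leq \chi^*_o(\mathcal{P}_{g_\epsilon})\leq 4+\epsilon$.
   Context: An oriented graph is a finite directed graph with no directed cycle of length 1 or 2; its girth is the length of a shortest cycle of its underlying graph. $\mathcal{P}_g$ denotes the family of oriented planar graphs of girth at least $g$. For a set $S$ of $k$ colors, a $b$-fold oriented $k$-coloring of $G$ is a map $f$ from $V(G)$ to the $b$-element subsets of $S$ such that (i) $f(x)\cap f(y)=\emptyset$ for every arc $xy$, and (ii) for all arcs $xy, zw$, $f(x)\cap f(w)\neq\emptyset$ implies $f(y)\cap f(z)=\emptyset$. $\chi^b_o(G)$ is the minimum such $k$, $\chi^*_o(G)=\lim_{b\to\infty}\chi^b_o(G)/b=\inf_{b\ge1}\chi^b_o(G)/b$, and for a family $\mathcal{F}$, $\chi^*_o(\mathcal{F})$ is the maximum (supremum) of $\chi^*_o(G)$ over $G\in\mathcal{F}$. *)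

(* Defs.v *)
From HB Require Import structures.
From mathcomp Require Import all_boot all_order all_algebra.
From mathcomp Require Import all_classical all_reals all_analysis.
From mathcomp Require Import Rstruct Rstruct_topology.
Set Implicit Arguments. Unset Strict Implicit. Unset Printing Implicit Defensive.
Import Order.TTheory GRing.Theory Num.Theory.
Local Open Scope ring_scope.
Local Open Scope classical_set_scope.

Notation Rline := Rdefinitions.R.

Definition oriented (V : finType) (a : rel V) : Prop :=
  (forall x, ~~ a x x) /\ (forall x y, a x y -> ~~ a y x).

Definition uadj (V : finType) (a : rel V) : rel V := fun x y => a x y || a y x.

(* girth >= g : every cycle of the underlying simple graph (a sequence of
   at least 3 pairwise distinct vertices, cyclically consecutive ones adjacent)
   has length at least g.  (Acyclic graphs have infinite girth.) *)
Definition girth_ge (V : finType) (a : rel V) (g : nat) : Prop :=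
  forall s : seq V, uniq s -> (3 <= size s)%N -> cycle (uadj a) s -> (g <= size s)%N.

(* Planarity: a drawing in the plane R x R.  Vertices go to distinct points;
   each arc xy (equivalently each edge of the underlying graph, since at most
   one of xy, yx is an arc) goes to a simple continuous curve on [0,1] from
   pos x to pos y whose interior avoids all vertex points, and interiors of
   curves of distinct arcs are disjoint. *)
Definition planar (V : finType) (a : rel V) : Prop :=
  exists (pos : V -> Rline * Rline) (c : V -> V -> Rline -> Rline * Rline),
    injective pos /\
    (forall x y, a x y ->
       {within `[0%R, 1%R], continuous (c x y)} /\
       {in `[0%R, 1%R] &, injective (c x y)} /\
       c x y 0%R = pos x /\ c x y 1%R = pos y /\
       (forall t v, (0 < t < 1)%R -> c x y t <> pos v)) /\
    (forall x y z w, a x y -> a z w -> (x, y) <> (z, w) ->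
       forall t s, (0 < t < 1)%R -> (0 < s < 1)%R -> c x y t <> c z w s).

Definition planar_oriented_girth (V : finType) (a : rel V) (g : nat) : Prop :=
  oriented a /\ planar a /\ girth_ge a g.

Definition bfold_oriented_coloring (V : finType) (a : rel V) (b k : nat)
    (f : V -> {set 'I_k}) : Prop :=
  (forall x, #|f x| = b) /\
  (forall x y, a x y -> f x :&: f y = finset.set0) /\
  (forall x y z w, a x y -> a z w -> f x :&: f w != finset.set0 -> f y :&: f z = finset.set0).

Definition bfold_colorable (V : finType) (a : rel V) (b k : nat) : Prop :=
  exists f : V -> {set 'I_k}, @bfold_oriented_coloring V a b k f.

(* chi*_o(G) = inf_{b >= 1} chi^b_o(G) / b
            = inf { k / b | b >= 1, G has a b-fold oriented k-colouring } *)
Definition frac_oriented_chi (V : finType) (a : rel V) : \bar Rline :=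
  ereal_inf [set r | exists b k : nat, (0 < b)%N /\ bfold_colorable a b k /\
                       r = ((k%:R / b%:R : Rline)%:E)].

Definition frac_oriented_chi_planar_girth (g : nat) : \bar Rline :=
  ereal_sup [set r | exists (V : finType) (a : rel V),
                       planar_oriented_girth a g /\ r = frac_oriented_chi a].

(* Main.v *)
(** Upper bound.  With [k = 4 b + 1] colours, assign to [x] the cyclic interval
    of length [b] starting at [phi x], where [phi y - phi x] is [b] or [b + 1]
    mod [k] along every arc [xy]; this is a [b]-fold oriented colouring.  Such a
    [phi] extends over a vertex of degree at most 1, and over a path of [4 b]
    vertices of degree 2, since the two admissible values at each of its arcs
    add up to every residue.  A graph of huge girth without these
    configurations has at least [(1 + c) |V|] edges; contracting stars of
    dominating sets makes it as dense as one likes while keeping it simple, so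
    it has a [K5] minor.  A plane drawing has none: for two disjoint curves, the
    parities of the crossings of each with the vertical rays above the ends of
    the other add up to 1 exactly when the abscissae of their ends interleave,
    and summing this over the disjoint pairs of edges of [K5] gives [0 = 1].

    Lower bound.  Let [r] be a power of 2 and suppose that the directed
    [r]-cycle has a [b]-fold colouring with fewer than [4 b] colours.  No four
    colour sets are pairwise disjoint, and a meeting of the [i]-th and [j]-th
    sets forbids one of the [(i+1)]-st and [(j-1)]-st.  These rules force the
    intersection pattern to be invariant under rotations of the cycle, then to
    have period [r / 2], [r / 4], and finally 4, which is absurd. *)

Require Import Defs.
From mathcomp Require Import all_boot all_order all_algebra.
From mathcomp Require Import all_classical all_reals all_analysis.
From mathcomp Require Import Rstruct Rstruct_topology.
From mathcomp Require Import zify lra.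
From Stdlib Require Import Btauto.
Import Order.TTheory GRing.Theory Num.Theory.
Set Implicit Arguments. Unset Strict Implicit. Unset Printing Implicit Defensive.

(** * Clique minors of dense graphs *)

Section Minors.
Variable V : finType.
Implicit Types (U B X : {set V}) (e : rel V).

(** An edge of a symmetric [e] is counted in both directions, whence the factors 2 in the density
    bounds. *)
Definition darts U e : {set V * V} :=
  [set p | [&& p.1 \in U, p.2 \in U & e p.1 p.2]].

Definition nbhd U e u : {set V} := [set v in U | e u v].

Definition connected_in e B : Prop :=
  {in B &, forall x y, connect [rel u v | [&& u \in B, v \in B & e u v]] x y}.

Definition clique_minor t U e : Prop :=
  exists B : nat -> {set V},
    (forall i, i < t -> [/\ B i \subset U, B i != finset.set0 & connected_in e (B i)]) /\
    (forall i j, i < j -> j < t -> [disjoint B i & B j] /\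
       exists u v, [/\ u \in B i, v \in B j & e u v]).

(** Encodes a partition of [U] into stars with centres [U'], where [c] sends each vertex to its
    centre. *)
Definition star_contraction U e (c : V -> V) U' : Prop :=
  [/\ U' \subset U, {in U, forall u, c u \in U'}, {in U', forall u, c u = u} &
      {in U, forall u, u != c u -> e u (c u)}].

Definition quotient U e (c : V -> V) : rel V :=
  fun u v => (u != v) && [exists p in darts U e, (c p.1 == u) && (c p.2 == v)].

Lemma card_darts U e : #|darts U e| = \sum_(u in U) #|nbhd U e u|.
Proof.
rewrite -sum1_card (eq_bigl (fun p : V * V => (p.1 \in U) && ((p.2 \in U) && e p.1 p.2))); last first.
  by move=> p; rewrite inE.
rewrite -(pair_big_dep (mem U) (fun u v => (v \in U) && e u v) (fun _ _ => 1)) /=.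
apply: eq_bigr => u _; rewrite -sum1_card; apply: eq_bigl => v.
by rewrite inE.
Qed.

Lemma quotient_sym U e c : symmetric e -> symmetric (quotient U e c).
Proof.
move=> es; suff H u v : quotient U e c u v -> quotient U e c v u.
  by move=> u v; apply/idP/idP; apply: H.
case/andP=> uv /existsP[[p q]]; rewrite !inE /= => /andP[/and3P[pU qU epq] /andP[pu qv]].
rewrite /quotient eq_sym uv; apply/existsP; exists (q, p).
by rewrite inE /= pU qU es epq pu qv.
Qed.

Lemma quotient_irr U e c : irreflexive (quotient U e c).
Proof. by move=> u; rewrite /quotient eqxx. Qed.

Lemma clique_minor_sub t U U' e :
  U' \subset U -> clique_minor t U' e -> clique_minor t U e.
Proof.
move=> sU [B [HB1 HB2]]; exists B; split=> // i /HB1[BU B0 Bc]; split=> //.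
exact: fintype.subset_trans BU sU.
Qed.

(** Branch sets pull back along [c]: each vertex is linked to its centre inside its own fibre, and
    every quotient edge lifts to an edge of [e]. *)
Lemma clique_minor_quotient t U e c U' : symmetric e ->
  star_contraction U e c U' -> clique_minor t U' (quotient U e c) ->
  clique_minor t U e.
Proof.
move=> es [sU cU' cid cadj] [B [HB1 HB2]].
pose F i : {set V} := [set u in U | c u \in B i].
exists F; split=> [i it|i j ij jt].
  have [BU B0 Bc] := HB1 i it.
  have sBF x : x \in B i -> x \in F i.
    by move=> xB; have xU' := fintype.subsetP BU _ xB; rewrite inE (fintype.subsetP sU) //= cid.
  split.
  - by apply/fintype.subsetP=> u; rewrite inE => /andP[].
  - by case/set0Pn: B0 => x xB; apply/set0Pn; exists x; apply: sBF.
  pose R := [rel u v | [&& u \in F i, v \in F i & e u v]].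
  have Rs : connect_sym R.
    by apply: sym_connect_sym => u v /=; rewrite es andbCA.
  have Rc u : u \in F i -> connect R u (c u).
    move=> uF; have := uF; rewrite inE => /andP[uU cuB].
    have [<-//|ne] := eqVneq u (c u).
    by apply: connect1; rewrite /= uF sBF //= cadj.
  have RB x y : x \in B i -> y \in B i -> connect R x y.
    move=> xB yB; have := Bc x y xB yB; apply: connect_sub => {x y xB yB} x y /=.
    case/and3P=> xB yB /andP[_ /existsP[[p q]]].
    rewrite inE /= => /andP[/and3P[pU qU epq] /andP[/eqP cp /eqP cq]].
    have pF : p \in F i by rewrite inE pU cp.
    have qF : q \in F i by rewrite inE qU cq.
    apply: (@connect_trans _ _ p); first by rewrite Rs -cp Rc.
    apply: (@connect_trans _ _ q); last by rewrite -cq Rc.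
    by apply: connect1; rewrite /= pF qF.
  move=> u v uF vF; apply: (connect_trans (Rc u uF)).
  rewrite Rs; apply: (connect_trans (Rc v vF)); rewrite Rs.
  by move: uF vF; rewrite !inE => /andP[_ ?] /andP[_ ?]; apply: RB.
have [dB [u [v [uB vB /andP[_ /existsP[[p q]]]]]]] := HB2 i j ij jt.
rewrite inE /= => /andP[/and3P[pU qU epq] /andP[/eqP cp /eqP cq]].
split; last by exists p, q; rewrite !inE pU qU cp cq.
rewrite finset.disjoints_subset; apply/fintype.subsetP=> w; rewrite !inE => /andP[wU cwB].
by rewrite wU (disjointFr dB).
Qed.

(** Contracting [y] into [x] loses the edge [xy] and, for every common neighbour, one of two edges
    that become parallel. The set [bad] collects these darts at [y]; the contraction is injective on
    the others. *)
Lemma card_darts_contract_edge U e x y : symmetric e -> irreflexive e ->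
  x \in U -> y \in U -> e x y ->
  let c := fun u => if u == y then x else u in
  #|darts U e| <= #|darts (U :\ y) (quotient U e c)|
                  + 2 * (#|[set z in U | e x z && e y z]|).+1.
Proof.
move=> es ei xU yU exy; cbv zeta; set c := fun u => if u == y then x else u.
set C := [set z in U | e x z && e y z].
have xy : x != y by apply: contraL exy => /eqP->; rewrite ei.
pose bad : {set V * V} := [set (y, z) | z in x |: C] :|: [set (z, y) | z in x |: C].
have cbad : #|bad| <= 2 * #|C|.+1.
  apply: leq_trans (leq_card_setU _ _) _.
  have cC : #|x |: C| <= #|C|.+1 by rewrite cardsU1; case: (_ \notin _).
  rewrite mul2n -addnn; apply: leq_add; apply: leq_trans (leq_imset_card _ _) cC.
rewrite -(cardsID bad (darts U e)) addnC; apply: leq_add; last first.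
  by apply: leq_trans cbad; apply/subset_leq_card/subsetIr.
pose F (p : V * V) := (c p.1, c p.2).
have notbad p : p \in darts U e :\: bad ->
  [/\ p.1 \in U, p.2 \in U, e p.1 p.2, p.1 = y -> (p.2 != x) && ~~ e x p.2
   & p.2 = y -> (p.1 != x) && ~~ e x p.1].
  case: p => p q; rewrite !inE /= negb_or => /andP[/andP[b1 b2] /and3P[pU qU epq]].
  split=> // E; subst; rewrite -negb_or.
    apply: contra b1 => /orP[/eqP->|exq]; apply/imsetP; [exists x|exists q] => //; rewrite !inE ?eqxx //.
    by rewrite qU exq epq orbT.
  apply: contra b2 => /orP[/eqP->|exq]; apply/imsetP; [exists x|exists p] => //; rewrite !inE ?eqxx //.
  by rewrite pU exq es epq orbT.
rewrite -(@card_in_imset _ _ F).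
  apply/subset_leq_card/fintype.subsetP=> q /imsetP[p pD ->{q}].
  have [pU qU epq h1 h2] := notbad p pD; rewrite inE /= /F /c !inE /=.
  have ne : c p.1 != c p.2.
    rewrite /c; case: (eqVneq p.1 y) => E1; case: (eqVneq p.2 y) => E2.
    - by move: epq; rewrite E1 E2 ei.
    - by have /andP[] := h1 E1; rewrite eq_sym.
    - by have /andP[] := h2 E2.
    - by apply: contraL epq => /eqP->; rewrite ei.
  apply/and3P; split; [by case: (eqVneq p.1 y) => E; rewrite ?xy ?E ?xU|by case: (eqVneq p.2 y) => E; rewrite ?xy ?E ?xU|].
  rewrite /quotient ne; apply/existsP; exists p; rewrite inE pU qU epq /=.
  by rewrite /c !eqxx.
move=> [p q] [p' q'] /notbad[/= pU qU epq h1 h2] /notbad[/= pU' qU' epq' h1' h2'].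
rewrite /F /c /=; case.
case: (eqVneq p y) => Ep; case: (eqVneq p' y) => Ep'; case: (eqVneq q y) => Eq; case: (eqVneq q' y) => Eq';
  move=> E1 E2; subst; try by []; try by rewrite ei in epq; try by rewrite ei in epq'.
all: try by rewrite ei in epq.
all: try by rewrite ei in epq'.
all: try by rewrite exy in h1.
all: try have := h1 erefl; try have := h2 erefl; try have := h1' erefl; try have := h2' erefl.
all: rewrite ?eqxx ?epq ?epq' ?andbF //.
all: try by rewrite es epq ?andbF.
all: try by rewrite es epq' ?andbF.
Qed.

End Minors.

(** For [t.+1]: an edge with fewer than [2 ^ t] common neighbours can be contracted without spoiling
    the density bound. If there is none, every neighbourhood has minimum degree at least [2 ^ t],
    and its centre [x] completes a smaller clique minor found there. *)
Theorem dense_clique_minor (V : finType) t (U : {set V}) e : symmetric e -> irreflexive e ->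
  U != finset.set0 -> 2 ^ t * #|U| <= #|darts U e| -> clique_minor t U e.
Proof.
elim: t U e => [|t IHt] U e; first by exists (fun=> finset.set0).
have [n] := ubnP #|U|; elim: n U e => // n IHn U e ltUn es ei U0 dU.
have [/existsP[[x y]]|] := boolP [exists p in darts U e,
    #|[set z in U | e p.1 z && e p.2 z]| < 2 ^ t].
  rewrite inE /= => /andP[/and3P[xU yU exy] cxy].
  have xy : x != y by apply: contraL exy => /eqP->; rewrite ei.
  pose c := fun u => if u == y then x else u.
  have stc : star_contraction U e c (U :\ y).
    rewrite /c; split.
    - exact: subD1set.
    - by move=> u uU; rewrite !inE; case: (eqVneq u y) => E; rewrite ?xy ?E.
    - by move=> u; rewrite !inE => /andP[/negPf->].
    - by move=> u uU; case: (eqVneq u y) => [->|]; rewrite ?eqxx // es.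
  apply: clique_minor_quotient (stc) _ => //; apply: IHn.
  - by move: ltUn; rewrite (cardsD1 y U) yU.
  - exact: quotient_sym.
  - exact: quotient_irr.
  - by apply/set0Pn; exists x; rewrite !inE xy.
  have := card_darts_contract_edge es ei xU yU exy.
  rewrite -/c /=; move: dU; rewrite (cardsD1 y U) yU expnS.
  move: cxy; set A := #|_|; set D := #|darts _ _|; set D' := #|_|; set W := #|_|.
  move: (2 ^ t) => s; nia.
rewrite negb_exists => /forallP H.
have /card_gt0P[[x y] xyD] : 0 < #|darts U e|.
  by apply: leq_trans dU; rewrite muln_gt0 expn_gt0 card_gt0.
have := xyD; rewrite inE /= => /and3P[xU yU exy].
have sN : nbhd U e x \subset U by apply/fintype.subsetP=> z; rewrite inE => /andP[].
have [||||B [HB1 HB2]] := IHt (nbhd U e x) e => //.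
  by apply/set0Pn; exists y; rewrite inE yU.
  rewrite card_darts mulnC -sum_nat_const; apply: leq_sum => z.
  rewrite inE => /andP[zU exz].
  have := H (x, z); rewrite inE xU zU exz /= -leqNgt => h; apply: leq_trans h _.
  by apply/subset_leq_card/fintype.subsetP=> w; rewrite !inE => /and3P[-> -> ->].
have xB i : i < t -> x \notin B i.
  move=> /HB1[BN _ _]; apply: contraFN (ei x) => /(fintype.subsetP BN).
  by rewrite inE xU.
exists (fun i => if i == t then [set x] else B i)%SET; split=> [i|i j ij].
  rewrite ltnS leq_eqVlt; case: eqP => [_ _|_ /= /HB1[BN B0 Bc]].
    split; first by rewrite finset.sub1set.
      by apply/set0Pn; exists x; rewrite inE.
    by move=> u v /set1P-> /set1P->; apply: connect0.
  by split=> //; apply: fintype.subset_trans BN sN.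
rewrite ltnS leq_eqVlt; case: (eqVneq j t) ij => [-> it _|_ ij /= jt].
  rewrite (ltn_eqF it); split.
    by rewrite disjoint_sym disjoints1 xB.
  have [BN /set0Pn[u uB] _] := HB1 _ it.
  exists u, x; rewrite inE eqxx; split=> //.
  by have := fintype.subsetP BN _ uB; rewrite inE es => /andP[].
by rewrite (ltn_eqF (ltn_trans ij jt)); apply: HB2.
Qed.

(** * Star contractions of locally sparse graphs *)

Section Sparse.
Variable V : finType.
Implicit Types (U D X : {set V}) (e : rel V) (c : V -> V).

(** For a symmetric irreflexive [e]: any [n] vertices or fewer span a forest. Unlike a bound on
    cycle lengths, this counting form passes easily to quotients. *)
Definition sparse n U e : Prop :=
  forall X, X \subset U -> X != finset.set0 -> #|X| <= n -> #|darts X e| < 2 * #|X|.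

Lemma sparse_sub n U U' e : U' \subset U -> sparse n U e -> sparse n U' e.
Proof. by move=> sU sp X XU; apply: sp; apply: fintype.subset_trans XU sU. Qed.

Lemma sparse_leq m n U e : m <= n -> sparse n U e -> sparse m U e.
Proof. by move=> mn sp X XU X0 Xm; apply: sp => //; apply: leq_trans mn. Qed.

(* A star-closed set with |S| >= 2 |X :&: D| non-star darts spans at least
   as many edges as vertices, the stars contributing one edge per leaf. *)
Lemma card_nonstar_darts n U e c D X (S : {set V * V}) : symmetric e ->
  star_contraction U e c D -> sparse n U e ->
  X \subset U -> {in X, forall u, c u \in X} -> X != finset.set0 -> #|X| <= n ->
  S \subset darts X e -> {in S, forall p, (p.2 != c p.1) && (p.1 != c p.2)} ->
  #|S| < 2 * #|X :&: D|.
Proof.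
move=> es [sU cU cid cadj] sp XU cX X0 Xn SX Sns.
pose T1 : {set V * V} := [set (u, c u) | u in X :\: D].
pose T2 : {set V * V} := [set (c u, u) | u in X :\: D].
have T1P p : p \in T1 -> [/\ p.1 \in X, p.1 \notin D & p.2 = c p.1].
  by case/imsetP=> w; rewrite inE => /andP[wD wX] ->.
have T2P p : p \in T2 -> [/\ p.2 \in X, p.2 \notin D & p.1 = c p.2].
  by case/imsetP=> w; rewrite inE => /andP[wD wX] ->.
have cT1 : #|T1| = #|X :\: D| by rewrite card_imset // => u v [].
have cT2 : #|T2| = #|X :\: D| by rewrite card_imset // => u v [].
have XinU u : u \in X -> u \in U by apply: (fintype.subsetP XU).
have d12 : [disjoint T1 & T2].
  rewrite finset.disjoints_subset; apply/fintype.subsetP=> p /T1P[pX pD _]; rewrite inE.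
  apply/negP=> /T2P[pX' _ E]; move: pD; rewrite E cU //; exact: XinU.
have dS : [disjoint T1 :|: T2 & S].
  rewrite finset.disjoints_subset; apply/fintype.subsetP=> p pT; rewrite inE.
  apply/negP=> /Sns /andP[/eqP n1 /eqP n2].
  by move: pT; rewrite inE => /orP[/T1P[_ _ /n1]|/T2P[_ _ /n2]].
have ne u : u \in X -> u \notin D -> u != c u.
  by move=> uX; apply: contra => /eqP->; apply: cU; apply: XinU.
have sub : (T1 :|: T2) :|: S \subset darts X e.
  rewrite finset.subUset SX andbT; apply/fintype.subsetP=> -[p q]; rewrite !inE /=.
  case/orP=> [/T1P|/T2P] /= [pX pD ->]; rewrite pX cX //=; last rewrite es.
    by apply: cadj; [apply: XinU|apply: ne].
  by apply: cadj; [apply: XinU|apply: ne].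
have := subset_leq_card sub.
rewrite (eqP (etrans (leq_card_setU _ _).2 dS)) (eqP (etrans (leq_card_setU _ _).2 d12)) cT1 cT2.
have := sp X XU X0 Xn; rewrite -[#|X|](cardsID D).
set A := #|S|; set B := #|X :&: D|; set C := #|X :\: D|; set E := #|_|; lia.
Qed.

(** A dense [X] in the quotient has [2 * #|X|] darts; lifting them gives non-star darts of [e] on
    [X] and their ends, at most [5 * #|X|] vertices, against [card_nonstar_darts]. *)
Lemma quotient_sparse n U e c D : symmetric e -> star_contraction U e c D ->
  sparse (5 * n) U e -> sparse n D (quotient U e c).
Proof.
move=> es stc sp X XD X0 Xn; have [sU cU cid cadj] := stc.
rewrite ltnNge; apply/negP=> /card_geqP[s [us ss sX]].
pose lift p := odflt p [pick d in darts U e | (c d.1 == p.1) && (c d.2 == p.2)].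
have liftP p : p \in s -> [/\ lift p \in darts U e, c (lift p).1 = p.1, c (lift p).2 = p.2,
    p.1 \in X /\ p.2 \in X & p.1 != p.2].
  move=> /sX; rewrite inE => /and3P[p1 p2 /andP[pp /existsP[d /andP[dU /andP[d1 d2]]]]].
  rewrite /lift; case: pickP => [d' /andP[d'U /andP[/eqP ? /eqP ?]] //|/(_ d)].
  by rewrite dU d1 d2.
pose S : {set V * V} := [set lift p | p in s].
pose Y := X :|: ([set (lift p).1 | p in s] :|: [set (lift p).2 | p in s])%SET.
have sz : #|s| = 2 * #|X| by rewrite -ss; apply/card_uniqP.
have cS : #|S| = 2 * #|X|.
  rewrite card_in_imset // => -[p p'] [q q'] /liftP[_ /= p1 p2 _ _] /liftP[_ /= q1 q2 _ _] E.
  by congr pair; [rewrite -p1 E|rewrite -p2 E].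
have XinU u : u \in X -> u \in U by move=> /(fintype.subsetP XD)/(fintype.subsetP sU).
have XcX u : u \in X -> c u = u by move=> /(fintype.subsetP XD)/cid.
have YP u : u \in Y -> (u \in U) && (c u \in X).
  rewrite !inE => /or3P[uX|/imsetP[p ps ->]|/imsetP[p ps ->]].
  - by rewrite XinU // XcX.
  - by have [] := liftP p ps; rewrite inE => /and3P[-> _ _] -> _ [-> _].
  - by have [] := liftP p ps; rewrite inE => /and3P[_ -> _] _ -> [_ ->].
have XY u : u \in X -> u \in Y by rewrite inE => ->.
have : #|S| < 2 * #|Y :&: D|.
  apply: (card_nonstar_darts es stc sp).
  - by apply/fintype.subsetP=> u /YP /andP[].
  - by move=> u /YP /andP[_ /XY].
  - by case/set0Pn: X0 => x /XY xY; apply/set0Pn; exists x.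
  - have h1 : #|[set (lift p).1 | p in s]| <= 2 * #|X| by rewrite -sz leq_imset_card.
    have h2 : #|[set (lift p).2 | p in s]| <= 2 * #|X| by rewrite -sz leq_imset_card.
    apply: leq_trans (leq_card_setU _ _) _; apply: (@leq_trans (#|X| + (2 * #|X| + 2 * #|X|))).
      by rewrite leq_add2l; apply: leq_trans (leq_card_setU _ _) (leq_add h1 h2).
    by rewrite addnA -mulSn -mulnDl leq_mul2l Xn.
  - apply/fintype.subsetP=> d /imsetP[p ps ->]; have [] := liftP p ps.
    rewrite !inE => /and3P[_ _ ep] _ _ _ _.
    apply/and3P; split=> //; apply/orP; right; apply/orP; [left|right];
      by apply/imsetP; exists p.
  - move=> d /imsetP[p ps ->]; have [] := liftP p ps.
    rewrite inE => /and3P[l1 l2 _] E1 E2 _ ne.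
    rewrite E1 E2; apply/andP; split; apply: contra ne => /eqP E.
      by rewrite -E2 E cid // -E1 cU.
    by rewrite -E1 E cid // -E2 cU.
rewrite cS; apply/negP; rewrite -leqNgt leq_mul2l /=.
apply/subset_leq_card/fintype.subsetP=> u; rewrite inE => /andP[/YP/andP[_ cuX] uD].
by rewrite -(cid u uD).
Qed.

(** Only the star edges get lost, two darts per leaf: a further edge inside a star, or two edges
    between the same stars, would close a cycle on at most six vertices. *)
Lemma card_darts_quotient U e c D : symmetric e -> irreflexive e ->
  star_contraction U e c D -> sparse 6 U e ->
  #|darts U e| <= #|darts D (quotient U e c)| + 2 * #|U :\: D|.
Proof.
move=> es ei stc sp; have [sU cU cid cadj] := stc.
pose bad : {set V * V} := [set (u, c u) | u in U :\: D] :|: [set (c u, u) | u in U :\: D].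
have cbad : #|bad| <= 2 * #|U :\: D|.
  by apply: leq_trans (leq_card_setU _ _) _; rewrite mul2n -addnn; apply: leq_add; apply: leq_imset_card.
rewrite -(cardsID bad (darts U e)) addnC; apply: leq_add; last first.
  by apply: leq_trans cbad; apply/subset_leq_card/subsetIr.
have good p : p \in darts U e :\: bad ->
  [/\ p.1 \in U, p.2 \in U, e p.1 p.2 & (p.2 != c p.1) && (p.1 != c p.2)].
  rewrite !inE negb_or; case: p => p q /= /andP[/andP[b1 b2] /and3P[pU qU epq]].
  split=> //; apply/andP; split; apply/eqP=> E; subst.
    case/negP: b1; apply/imsetP; exists p; rewrite // inE pU andbT.
    by apply: contraL epq => /cid ->; rewrite ei.
  case/negP: b2; apply/imsetP; exists q; rewrite // inE qU andbT.
  by apply: contraL epq => /cid ->; rewrite ei.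
(* Both violations are refuted in this way, by a star-closed set of at most six vertices with
   centres [x] and [y]. *)
have key (X : {set V}) (S : {set V * V}) x y :
    {in X, forall u, (u \in U) && (c u \in X)} -> x \in X -> y \in X -> #|X| <= 6 ->
    {in X, forall u, (c u == x) || (c u == y)} ->
    S \subset darts X e -> {in S, forall p, (p.2 != c p.1) && (p.1 != c p.2)} ->
    #|S| < 2 * (x != y).+1.
  move=> XU xX yX X6 Xxy SX Sns.
  have XU' : X \subset U by apply/fintype.subsetP=> u /XU /andP[].
  have cX : {in X, forall u, c u \in X} by move=> u /XU /andP[].
  have X0 : X != finset.set0 by apply/set0Pn; exists x.
  apply: leq_trans (card_nonstar_darts es stc sp XU' cX X0 X6 SX Sns) _.
  rewrite leq_mul2l /= -cards2; apply/subset_leq_card/fintype.subsetP=> u.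
  rewrite !inE => /andP[/Xxy + /cid E]; by rewrite E.
have ne p : p \in darts U e :\: bad -> c p.1 != c p.2.
  move=> /good [p1 p2 ep np]; apply/negP=> /eqP E.
  have pq : p.1 != p.2 by apply: contraL ep => /eqP->; rewrite ei.
  have cS : #|[set p; (p.2, p.1)]| = 2.
    by rewrite cards2; case: (p) pq => a b /=; rewrite xpair_eqE => /negPf->.
  suff: #|[set p; (p.2, p.1)]| < 2 * (c p.1 != c p.1).+1 by rewrite cS eqxx.
  have cp := cU _ p1; have cpU := fintype.subsetP sU _ cp; have cc := cid _ cp.
  apply: (key [set p.1; p.2; c p.1]).
  - by move=> u; rewrite !inE -!orbA => /or3P[]/eqP->; rewrite ?p1 ?p2 ?cpU -?E ?cc eqxx ?orbT.
  - by rewrite !inE eqxx orbT.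
  - by rewrite !inE eqxx orbT.
  - by rewrite cardsU; apply: leq_trans (leq_subr _ _) _; rewrite cards2 cards1; case: (_ != _).
  - by move=> u; rewrite !inE orbb -!orbA => /or3P[]/eqP->; rewrite -?E ?cc ?eqxx.
  - by apply/fintype.subsetP=> q; rewrite !inE => /orP[]/eqP-> /=; rewrite ?eqxx ?orbT //= ?ep ?(es p.2) ?ep.
  - by move=> q; rewrite !inE => /orP[]/eqP-> //=; rewrite andbC.
pose F (p : V * V) := (c p.1, c p.2).
rewrite -(@card_in_imset _ _ F).
  apply/subset_leq_card/fintype.subsetP=> q /imsetP[p pD ->{q}].
  have := ne p pD; have [p1 p2 ep _] := good p pD => nep.
  rewrite inE /= !cU //= /quotient nep; apply/existsP; exists p.
  by rewrite inE p1 p2 ep !eqxx.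
(* Two distinct non-star edges between the same two stars: four darts on their four ends and two
   centres. *)
move=> p q pD qD [E1 E2]; apply/eqP; apply/negP=> /negP pq.
have nep := ne p pD; have neq := ne q qD.
have [p1 p2 ep np] := good p pD; have [q1 q2 eq nq] := good q qD.
have pp : p.1 != p.2 by apply: contraL ep => /eqP->; rewrite ei.
have qq : q.1 != q.2 by apply: contraL eq => /eqP->; rewrite ei.
pose X := [set p.1; p.2; q.1; q.2; c p.1; c p.2].
pose S := [set p; (p.2, p.1); q; (q.2, q.1)].
have XP u : u \in X -> [\/ u = p.1, u = p.2, u = q.1 | u = q.2] \/ (u = c p.1 \/ u = c p.2).
  rewrite !inE -!orbA => /orP[/eqP|/orP[/eqP|/orP[/eqP|/orP[/eqP|/orP[/eqP|/eqP]]]]] ->.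
  all: try by left; constructor.
  by right; left.
  by right; right.
have cS : #|S| = 4.
  have : uniq [:: p; (p.2, p.1); q; (q.2, q.1)].
    move: pq pp qq nep neq E1 E2; case: (p) => a b; case: (q) => a' b' /=.
    rewrite !inE !xpair_eqE => pq pp qq nep neq E1 E2.
    have /negPf-> : a != b' by apply: contraNneq nep => ->; rewrite E2.
    have /negPf-> : b != a' by apply: contraNneq nep => ->; rewrite E1.
    rewrite (negPf pp) (negPf qq); move: pq.
    by case: (a == a'); case: (b == b').
  by move/card_uniqP => /= <-; apply: eq_card => d; rewrite !inE -!orbA.
suff: #|S| < 2 * (c p.1 != c p.2).+1 by rewrite cS nep.
have cD1 := cU _ p1; have cU1 := fintype.subsetP sU _ cD1; have cc1 := cid _ cD1.
have cD2 := cU _ p2; have cU2 := fintype.subsetP sU _ cD2; have cc2 := cid _ cD2.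
apply: (key X).
- by move=> u /XP [[]|[]] ->; rewrite ?p1 ?p2 ?q1 ?q2 ?cU1 ?cU2 -?E1 -?E2 ?cc1 ?cc2 !inE eqxx ?orbT.
- by rewrite !inE eqxx !orbT.
- by rewrite !inE eqxx !orbT.
- apply: leq_trans (leq_card_setU _ _) _; rewrite cards1 addn1 ltnS.
  apply: leq_trans (leq_card_setU _ _) _; rewrite cards1 addn1 ltnS.
  apply: leq_trans (leq_card_setU _ _) _; rewrite cards1 addn1 ltnS.
  apply: leq_trans (leq_card_setU _ _) _; rewrite cards1 addn1 ltnS cards2.
  by case: (_ != _).
- by move=> u /XP [[]|[]] ->; rewrite -?E1 -?E2 ?cc1 ?cc2 ?eqxx ?orbT.
- by apply/fintype.subsetP=> d; rewrite !inE -!orbA => /or4P[]/eqP-> /=; rewrite ?eqxx ?orbT //= ?ep ?eq ?(es p.2) ?(es q.2) ?ep ?eq.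
- by move=> d; rewrite !inE -!orbA => /or4P[]/eqP-> //=; rewrite andbC.
Qed.

End Sparse.

(** * Dominating sets and repeated star contraction *)

Section Domination.
Variable V : finType.
Implicit Types (U D : {set V}) (e : rel V).

(* Ore: the complement of a minimal dominating set is again dominating. *)
Lemma small_dominating_set U e : symmetric e -> irreflexive e ->
  {in U, forall u, exists2 v, v \in U & e u v} ->
  exists D, [/\ D \subset U, 2 * #|D| <= #|U| &
    {in U :\: D, forall u, exists2 v, v \in D & e u v}].
Proof.
move=> es ei noiso.
pose dom D := (D \subset U) && [forall u in U :\: D, [exists v in D, e u v]].
have domP D : dom D -> forall u, u \in U -> u \notin D -> exists2 v, v \in D & e u v.
  by case/andP=> _ /forall_inP H u uU uD; apply/exists_inP/H; rewrite inE uD.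
have dU : dom U.
  by rewrite /dom subxx; apply/forall_inP=> u; rewrite inE; case: (u \in U).
have [D dD minD] := @arg_minnP _ U dom (fun D => #|D|) dU.
have DU : D \subset U by case/andP: dD.
(* If all neighbours of some [u] in [D] were in [D], then [D :\ u] would still dominate, against
   minimality. *)
have dC : dom (U :\: D).
  rewrite /dom subsetDl; apply/forall_inP=> u; rewrite !inE negb_and negbK andb_orl.
  rewrite andNb orbF => /andP[uD uU]; apply/exists_inP; apply: boolp.contrapT => H.
  have {}H v : v \in U -> e u v -> v \in D.
    by move=> vU euv; apply/negP=> /negP vD; apply: H; exists v; rewrite ?inE ?vD.
  suff: #|D| <= #|D :\ u| by rewrite (cardsD1 u D) uD ltnn.
  apply: minD; rewrite /dom (fintype.subset_trans (subD1set _ _) DU).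
  apply/forall_inP=> w; rewrite !inE negb_and negbK => /andP[wDu wU]; apply/exists_inP.
  have [->|wu] := eqVneq w u.
    have [v vU euv] := noiso u uU; exists v => //; rewrite !inE (H v) // andbT.
    by apply: contraL euv => /eqP->; rewrite ei.
  move: wDu; rewrite (negPf wu) /= => wD; have [v vD ewv] := domP _ dD w wU wD.
  exists v => //; rewrite !inE vD andbT; apply/negP=> /eqP vu.
  by move: wD; rewrite H // es -vu.
exists D; split=> // [|u].
  by rewrite mul2n -addnn -[#|U|](cardsID D) (finset.setIidPr DU) leq_add2l; apply: minD.
by rewrite inE => /andP[uD uU]; apply: domP.
Qed.

Lemma star_contraction_dominating U e D : D \subset U ->
  {in U :\: D, forall u, exists2 v, v \in D & e u v} ->
  exists c, star_contraction U e c D.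
Proof.
move=> DU domD.
pose c u := if u \in D then u else odflt u [pick v in D | e u v].
have cP u : u \in U -> c u \in D /\ (u != c u -> e u (c u)).
  move=> uU; rewrite /c; case: ifPn => [uD|uD]; first by rewrite eqxx.
  have [|v vD euv] := domD u; first by rewrite inE uD.
  by case: pickP => [w /andP[wD euw] //|/(_ v)]; rewrite vD euv.
exists c; split=> // [u /cP[]|u uD|u /cP[]] //.
by rewrite /c uD.
Qed.

(* Contracting the stars of a dominating set halves the number of vertices
   without decreasing |E| - |V|, so after k rounds the graph is dense. *)
Theorem sparse_clique_minor t k q U e : symmetric e -> irreflexive e ->
  U != finset.set0 -> sparse (6 * 5 ^ k) U e -> 2 * #|U| + q <= #|darts U e| ->
  2 ^ t * #|U| <= 2 ^ k * q -> clique_minor t U e.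
Proof.
elim: k U e => [|k IHk] U e es ei U0 sp dU Uq.
  apply: dense_clique_minor => //; apply: leq_trans Uq _.
  by rewrite mul1n; apply: leq_trans dU; apply: leq_addl.
have q0 : 0 < q.
  rewrite lt0n; apply/eqP=> q0; move: Uq; rewrite q0 muln0 leqn0 muln_eq0 expn_eq0 /=.
  by rewrite cards_eq0 (negPf U0).
(* Isolated vertices would obstruct a small dominating set; deleting them costs no dart. *)
pose U1 := [set u in U | nbhd U e u != finset.set0].
have sU1 : U1 \subset U by apply/fintype.subsetP=> u; rewrite inE => /andP[].
have inU1 u v : u \in U -> v \in U -> e u v -> u \in U1.
  by move=> uU vU euv; rewrite inE uU; apply/set0Pn; exists v; rewrite inE vU.
have dU1 : darts U1 e = darts U e.
  apply/setP=> -[u v]; rewrite !inE /=; apply/idP/idP.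
    by case/and3P=> /andP[-> _] /andP[-> _].
  case/and3P=> uU vU euv; have := inU1 _ _ uU vU euv; rewrite inE => ->.
  by have := inU1 v u; rewrite inE es euv uU vU => ->.
have noiso : {in U1, forall u, exists2 v, v \in U1 & e u v}.
  move=> u; rewrite inE => /andP[uU /set0Pn[v]]; rewrite inE => /andP[vU euv].
  by exists v => //; apply: (inU1 _ u) => //; rewrite es.
have [D [DU1 Dle domD]] := small_dominating_set es ei noiso.
have [c stc] := star_contraction_dominating DU1 domD.
have sp1 := sparse_sub sU1 sp.
apply: clique_minor_sub (sU1) _; apply: clique_minor_quotient (stc) _ => //.
apply: IHk.
- exact: quotient_sym.
- exact: quotient_irr.
- have : #|darts U1 e| != 0 by rewrite dU1 -lt0n; lia.
  rewrite cards_eq0 => /set0Pn[[u v]]; rewrite inE => /and3P[/= uU1 _ _].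
  have [uD|uD] := boolP (u \in D); first by apply/set0Pn; exists u.
  have [|w wD _] := domD u; first by rewrite inE uD.
  by apply/set0Pn; exists w.
- by apply: quotient_sparse (stc) _ => //; rewrite mulnCA -expnS.
- have := card_darts_quotient es ei stc (sparse_leq _ sp1); rewrite dU1.
  rewrite leq_pmulr ?expn_gt0 // => /(_ isT).
  have := subset_leq_card sU1; rewrite -[#|U1|](cardsID D) (finset.setIidPr DU1).
  by move: dU; lia.
have := subset_leq_card sU1; move: Uq Dle; rewrite expnS -mulnA.
set P := 2 ^ k * q; set Q := 2 ^ t; nia.
Qed.

End Domination.

(** * Non-backtracking walks and local sparsity *)

Section Girth.
Variable V : finType.
Implicit Types (U X : {set V}) (e : rel V).

Lemma path_map_iota e (f : nat -> V) a n : (forall i, e (f i) (f i.+1)) ->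
  path e (f a) (rcons (map f (iota a.+1 n)) (f (a + n).+1)).
Proof.
move=> ef; elim: n a => [|n IH] a /=; first by rewrite addn0 ef.
by rewrite ef addnS -addSn IH.
Qed.

(** A return after fewest steps closes a cycle with distinct vertices, which the girth forbids when
    it is short. *)
Lemma nonbacktracking_uniq e g (u : nat -> V) : irreflexive e -> symmetric e ->
  (forall s, uniq s -> 3 <= size s -> cycle e s -> g <= size s) ->
  (forall i, e (u i) (u i.+1)) -> (forall i, u i != u i.+2) ->
  forall i j, i < j -> j < i + g -> u i != u j.
Proof.
move=> ei es girth eu nb i j ij jg; have {ij jg} [d -> dg] : exists2 d, j = i + d.+1 & d.+1 < g.
  by exists (j - i.+1); lia.
elim/ltn_ind: d i dg => d IH i dg; apply/eqP=> E.
have inj a b : a < b -> b < d.+1 -> u (i + a) != u (i + b).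
  move=> ab bd; have -> : i + b = i + a + (b - a.+1).+1 by lia.
  by apply: IH; lia.
(* Irreflexivity excludes a return after one step and [nb] after two, so the cycle has at least
   three vertices. *)
have d2 : 1 < d.
  case: d E {IH inj dg} => [|[|//]]; rewrite ?addn1 ?addn2 => /eqP.
    by move=> /eqP E; have := eu i; rewrite -E ei.
  by rewrite (negPf (nb i)).
pose s := mkseq (fun a => u (i + a)) d.+1.
suff: g <= size s by rewrite size_mkseq; lia.
apply: girth; rewrite ?size_mkseq //.
  apply/mkseq_uniqP=> a b; rewrite !inE => ad bd Eab.
  case: (ltngtP a b) => // lab; [have := inj _ _ lab bd|have := inj _ _ lab ad];
    by rewrite Eab eqxx.
have := path_map_iota (f := fun a => u (i + a)) 0 d (fun a => eq_ind_r (e _) (eu _) (congr1 u (addnS i a))).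
by rewrite add0n -E addn0 /s /mkseq /= addn0.
Qed.

(* The value [v] returned when there is no other neighbour is junk. *)
Definition other_nbr U e v u := odflt v [pick w in nbhd U e v :\ u].

Definition next_dart U e (p : V * V) : V * V := (p.2, other_nbr U e p.2 p.1).

Definition walk U e (p : V * V) i := (iter i (next_dart U e) p).1.

Lemma other_nbrP U e v u : 1 < #|nbhd U e v| ->
  [/\ other_nbr U e v u \in U, e v (other_nbr U e v u) & other_nbr U e v u != u].
Proof.
move=> n2; rewrite /other_nbr; case: pickP => [w|H].
  by rewrite !inE => /and3P[-> -> ->].
move: n2; rewrite (cardsD1 u) (_ : #|_ :\ u| = 0) ?addn0; first by case: (_ \in _).
by apply: eq_card0.
Qed.

Lemma walkS U e p i : walk U e p i.+1 = (iter i (next_dart U e) p).2.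
Proof. by rewrite /walk iterS /next_dart. Qed.

Lemma walkP U e p : {in U, forall v, 1 < #|nbhd U e v|} -> p \in darts U e ->
  forall i, [/\ walk U e p i \in U, e (walk U e p i) (walk U e p i.+1) &
              walk U e p i != walk U e p i.+2].
Proof.
move=> deg2 pD.
have H i : iter i (next_dart U e) p \in darts U e.
  elim: i => // i; rewrite iterS; move: (iter _ _ _) => [u v].
  rewrite !inE /= => /and3P[uU vU euv]; have [oU ov _] := other_nbrP u (deg2 v vU).
  by rewrite vU oU ov.
move=> i; have := H i; rewrite walkS (walkS _ _ _ i.+1) /walk iterS.
move: (iter _ _ _) => [u v]; rewrite inE /= => /and3P[uU vU euv]; split=> //.
by rewrite eq_sym; have [] := other_nbrP u (deg2 v vU).
Qed.

Lemma walk_uniq U e p g : irreflexive e -> symmetric e ->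
  (forall s, uniq s -> 3 <= size s -> cycle e s -> g <= size s) ->
  {in U, forall v, 1 < #|nbhd U e v|} -> p \in darts U e ->
  uniq (mkseq (walk U e p) g).
Proof.
move=> ei es girth deg2 pD; have W := walkP deg2 pD.
have inj := nonbacktracking_uniq ei es girth (fun i => let: And3 _ h _ := W i in h)
  (fun i => let: And3 _ _ h := W i in h).
apply/mkseq_uniqP=> a b; rewrite !inE => ad bd Eab.
case: (ltngtP a b) => // lab; [have := inj _ _ lab|have := inj _ _ lab];
  by rewrite Eab eqxx (ltn_addl, ltn_addl) // => /(_ isT).
Qed.

Lemma darts_set0 e : #|darts finset.set0 e| = 0.
Proof. by apply: eq_card0 => p; rewrite !inE. Qed.

Lemma card_darts_setD1 X e v : symmetric e -> irreflexive e -> v \in X ->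
  #|darts X e| = #|darts (X :\ v) e| + 2 * #|nbhd X e v|.
Proof.
move=> es ei vX.
have E : #|nbhd X e v| = \sum_(u in X :\ v) e v u.
  rewrite -sum1_card big_mkcond [RHS]big_mkcond; apply: eq_bigr => u _; rewrite !inE.
  by have [->|] := eqVneq u v; rewrite ?ei ?andbF //=; case: (u \in X); case: (e v u).
rewrite !card_darts (bigD1 v) //= mul2n -addnn addnA [RHS]addnC; congr addn.
rewrite E (eq_bigl (mem (X :\ v))); last by move=> u; rewrite !inE andbC.
rewrite -big_split /=; apply: eq_bigr => u uX.
rewrite (cardsD1 v) addnC; congr addn.
  by apply: eq_card => w; rewrite !inE andbA.
by rewrite inE vX es /=; case: (e v u).
Qed.

(** Removing a vertex of degree at most 1 reduces to a smaller set. If there is none, a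
    non-backtracking walk visits [g] distinct vertices of [X], too many. *)
Lemma girth_sparse U e g : irreflexive e -> symmetric e ->
  (forall s, uniq s -> 3 <= size s -> cycle e s -> g <= size s) ->
  sparse g.-1 U e.
Proof.
move=> ei es girth X _; have [n] := ubnP #|X|; elim: n X => // n IH X ltXn X0 Xg.
have [[v vX dv]|H] := boolp.pselect (exists2 v, v \in X & #|nbhd X e v| <= 1).
  rewrite (card_darts_setD1 es ei vX) [#|X|](cardsD1 v) vX mulnDr addnC.
  have [X'0|X'0] := eqVneq (X :\ v) finset.set0.
    suff -> : #|nbhd X e v| = 0 by rewrite X'0 darts_set0 cards0.
    apply: eq_card0 => w; have /setP/(_ w) := X'0; rewrite !inE.
    by have [->|_ /= ->] := eqVneq w v; rewrite ?ei ?andbF.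
  have : #|darts (X :\ v) e| < 2 * #|X :\ v|; last by move: dv; rewrite /=; lia.
  by apply: IH => //; move: ltXn Xg; rewrite [#|X|](cardsD1 v) vX; lia.
have deg2 : {in X, forall v, 1 < #|nbhd X e v|}.
  by move=> v vX; rewrite ltnNge; apply/negP=> dv; apply: H; exists v.
have /set0Pn[x xX] := X0.
have /card_gt0P[y] : 0 < #|nbhd X e x| by apply: ltnW; apply: deg2.
rewrite inE => /andP[yX exy].
have xyD : (x, y) \in darts X e by rewrite !inE /= xX yX.
have g0 : 0 < g by move: X0 Xg; rewrite -card_gt0; lia.
suff : g <= #|X| by lia.
have <- : #|mkseq (walk X e (x, y)) g| = g.
  by rewrite (card_uniqP (walk_uniq ei es girth deg2 xyD)) size_mkseq.
apply/subset_leq_card/fintype.subsetP=> v /mapP[i _ ->].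
by have [] := walkP deg2 xyD i.
Qed.

End Girth.

(** * Threads of degree-2 vertices *)

Section Threads.
Variable V : finType.
Implicit Types (U : {set V}) (e : rel V).

Lemma nbhd2_eq U e v a b : #|nbhd U e v| = 2 -> a \in nbhd U e v -> b \in nbhd U e v ->
  a != b -> nbhd U e v = [set a; b].
Proof.
move=> n2 aN bN ab; apply/esym/eqP; rewrite eqEcard cards2 ab n2 leqnn andbT.
by apply/fintype.subsetP=> x; rewrite !inE => /orP[]/eqP->; move: aN bN; rewrite !inE.
Qed.

(** Walks can be reversed at vertices of degree 2; [long_thread] relies on this. *)
Lemma other_nbrK U e v u : #|nbhd U e v| = 2 -> u \in nbhd U e v ->
  other_nbr U e v (other_nbr U e v u) = u.
Proof.
move=> n2 uN; have n1 : 1 < #|nbhd U e v| by rewrite n2.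
have [wU ew wu] := other_nbrP u n1; set w := other_nbr U e v u in wU ew wu *.
have [xU ex xw] := other_nbrP w n1; set x := other_nbr U e v w in xU ex xw *.
have : x \in nbhd U e v by rewrite inE xU.
rewrite (nbhd2_eq n2 uN _ (a := u) (b := w)) ?inE ?wU // 1?eq_sym //.
by rewrite (negPf xw) orbF => /eqP.
Qed.

(* There are at most 3 (2 |E| - 2 |V|) darts leaving branching vertices, and
   without a thread every dart is reached from one of them in less than l steps. *)
Lemma long_thread U e l : symmetric e ->
  {in U, forall v, 1 < #|nbhd U e v|} ->
  l * (3 * (#|darts U e| - 2 * #|U|)) < #|darts U e| ->
  exists2 p, p \in darts U e & forall i, 0 < i <= l -> #|nbhd U e (walk U e p i)| = 2.
Proof.
move=> es deg2 few.
pose S := [set p in darts U e | 2 < #|nbhd U e p.1|].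
(* A degree [d > 2] satisfies [d <= 3 * (d - 2)], and the degrees add up to the number of darts. *)
have cS : #|S| <= 3 * (#|darts U e| - 2 * #|U|).
  have -> : #|S| = \sum_(u in U) if 2 < #|nbhd U e u| then #|nbhd U e u| else 0.
    rewrite -sum1_card (eq_bigl (fun p : V * V => ((p.1 \in U) && (2 < #|nbhd U e p.1|))
      && ((p.2 \in U) && e p.1 p.2))); last first.
      by move=> p; rewrite !inE [RHS]andbAC !andbA.
    rewrite -(pair_big_dep (fun u => (u \in U) && (2 < #|nbhd U e u|))
       (fun u v => (v \in U) && e u v) (fun _ _ => 1)) /= big_mkcondr /=.
    apply: eq_bigr => u _; case: ifP => // _; rewrite -sum1_card.
    by apply: eq_bigl => v; rewrite inE.
  rewrite card_darts (mulnC 2) -sum_nat_const -sumnB // big_distrr /=.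
  by apply: leq_sum => u /deg2; case: ifP; lia.
(* Fewer than [l] steps from [S] reach at most [l * #|S|] darts, not all of them. *)
have [d dD dn] : exists2 d, d \in darts U e &
    forall i p, i < l -> p \in S -> d != iter i (next_dart U e) p.
  apply: boolp.contrapT => H.
  suff : #|darts U e| <= #|finset.setX S [set: 'I_l]|.
    rewrite cardsX cardsT card_ord => h.
    by have := leq_trans h (leq_mul cS (leqnn l)); rewrite mulnC leqNgt few.
  apply: leq_trans (leq_imset_card (fun x : V * V * 'I_l => iter x.2 (next_dart U e) x.1) _).
  apply/subset_leq_card/fintype.subsetP=> d dD; apply: boolp.contrapT => dn.
  apply: H; exists d => // i p il pS; apply/eqP => E; apply: dn; apply/imsetP.
  by exists (p, Ordinal il) => //; rewrite finset.in_setX pS inE.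
case: d dD dn => u v; rewrite inE => /and3P[/= uU vU euv] dn.
have qD : (v, u) \in darts U e by rewrite !inE /= uU vU es.
set w := walk U e (v, u).
have W i : w i \in U /\ e (w i) (w i.+1) by have [] := walkP deg2 qD i.
exists (v, u) => // i /andP[i0 il].
(* If vertex [j.+1] of the walk were branching, the reversed walk would lead from there to [(u, v)]
   in [j < l] steps, against [dn]. *)
suff H j : j <= l -> (forall i, 0 < i <= j -> #|nbhd U e (w i)| = 2) /\
    iter j (next_dart U e) (w j.+1, w j) = (u, v).
  by have [h _] := H l (leqnn l); apply: h; rewrite i0.
elim: j => [_|j IH jl].
  by split=> // -[|i' /andP[]].
have [H1 H2] := IH (ltnW jl).
have dj : #|nbhd U e (w j.+1)| = 2.
  have [wU ew] := W j; have [w1U _] := W j.+1.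
  apply/eqP; rewrite eqn_leq deg2 // andbT leqNgt; apply/negP=> big.
  have wS : (w j.+1, w j) \in S by rewrite !inE /= wU w1U es ew.
  by have := dn j _ jl wS; rewrite H2 eqxx.
split=> [i' /andP[i'0]|].
  by rewrite leq_eqVlt ltnS => /orP[/eqP->|?] //; apply: H1; rewrite i'0.
have w2 : w j.+2 = other_nbr U e (w j.+1) (w j).
  by rewrite /w walkS iterS /next_dart /= -walkS.
rewrite iterSr (_ : next_dart U e _ = (w j.+1, w j)) // /next_dart /= w2 other_nbrK //.
by have [wU ew] := W j; rewrite inE wU es.
Qed.

(** Without a thread, [#|U|] is at most [3 * l] times the excess [#|darts U e| - 2 * #|U|], and [k]
    rounds of star contraction then give the minor. *)
Lemma thread_or_minor t k g l U e : symmetric e -> irreflexive e ->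
  (forall s, uniq s -> 3 <= size s -> cycle e s -> g <= size s) ->
  {in U, forall v, 1 < #|nbhd U e v|} -> U != finset.set0 ->
  2 ^ t * (3 * l) <= 2 ^ k -> 6 * 5 ^ k < g -> ~ clique_minor t U e ->
  exists2 p, p \in darts U e & forall i, 0 < i <= l -> #|nbhd U e (walk U e p i)| = 2.
Proof.
move=> es ei girth deg2 U0 tk kg nominor; apply: long_thread => //.
rewrite ltnNge; apply/negP=> few; apply: nominor.
have le2 : 2 * #|U| <= #|darts U e|.
  by rewrite card_darts mulnC -sum_nat_const; apply: leq_sum => u /deg2.
apply: (@sparse_clique_minor _ t k (#|darts U e| - 2 * #|U|)) => //.
- by apply: sparse_leq (girth_sparse ei es girth) => //; case: (g) kg.
- by rewrite subnKC.
move: few le2 tk; move: (#|darts U e|) (#|U|) (2 ^ t) (2 ^ k) => d u T K few le2 tk.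
have h : u <= l * (3 * (d - 2 * u)).
  by apply: leq_trans few; apply: leq_trans le2; apply: leq_pmull.
apply: leq_trans (leq_mul (leqnn T) h) _.
by rewrite mulnA mulnA -[T * l * 3]mulnA [l * 3]mulnC leq_mul2r tk orbT.
Qed.

End Threads.

(** * Labelling by cyclic intervals *)

Section Labelling.

Definition step b s t := (t == s + b %[mod (4 * b).+1]) || (t == (s + b).+1 %[mod (4 * b).+1]).

Lemma step_mod b s s' t t' : s = s' %[mod (4 * b).+1] -> t = t' %[mod (4 * b).+1] ->
  step b s t = step b s' t'.
Proof.
move=> Es Et; have E c : s + c = s' + c %[mod (4 * b).+1] by rewrite -modnDml Es modnDml.
by rewrite /step Et (E b) -[(s + b).+1]addnS (E b.+1) addnS.
Qed.

Lemma step_fwd b s (e : bool) : step b s (s + b + e).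
Proof. by rewrite /step; case: e; rewrite ?addn1 ?addn0 eqxx ?orbT. Qed.

(** Modulo [4 * b + 1], the opposites of [b + 1] and [b] are [3 * b] and [3 * b + 1]. *)
Lemma step_bwd b s (e : bool) : step b (s + 3 * b + e) s.
Proof.
rewrite /step; case: e; rewrite ?addn0.
  by rewrite (_ : _ + b = s + (4 * b).+1) ?modnDr ?eqxx //; lia.
by rewrite (_ : (_ + b).+1 = s + (4 * b).+1) ?modnDr ?eqxx ?orbT //; lia.
Qed.

(* With m >= 4 b steps, each having two admissible values differing by 1, the
   total displacement takes m + 1 consecutive values, hence all residues. *)
Lemma interpolate_steps b m (o : nat -> bool) a z : 4 * b <= m ->
  exists x : nat -> nat, [/\ x 0 = a, x m = z %[mod (4 * b).+1] &
    forall i, if o i then step b (x i) (x i.+1) else step b (x i.+1) (x i)].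
Proof.
move=> bm; pose B i := \sum_(0 <= t < i) if o t then b else 3 * b.
(* As [4 * b] is -1 modulo [4 * b + 1], [j] is the residue of [z - (a + B m)]. It counts the initial
   steps that take the larger of their two values. *)
pose j := (z + (a + B m) * (4 * b)) %% (4 * b).+1.
exists (fun i => a + B i + minn i j); split.
- by rewrite /B big_geq // min0n !addn0.
- have jm : j <= m by apply: leq_trans bm; rewrite -ltnS ltn_mod.
  by rewrite (minn_idPr jm) /j modnDmr addnCA -mulnS addnC modnMDl.
move=> i; have -> : a + B i.+1 + minn i.+1 j =
    a + B i + minn i j + (if o i then b else 3 * b) + (i < j).
  by rewrite /B big_nat_recr //=; case: ltnP; lia.
by case: (o i); [apply: step_fwd|apply: step_bwd].
Qed.

(** Any colour of the head of an arc is any colour of its tail plus some [r] with [1 <= r <= 2 * b].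
    Neither such an [r] nor a sum of two of them vanishes modulo [4 * b + 1], which gives both
    disjointness conditions. *)
Lemma bfold_of_labelling (V : finType) (a : rel V) b (phi : V -> nat) :
  (forall x y, a x y -> step b (phi x) (phi y)) -> bfold_colorable a b (4 * b).+1.
Proof.
move=> ok; set K := (4 * b).+1.
pose F v (i : 'I_b) : 'I_K := Ordinal (ltn_pmod (phi v + i) (ltn0Sn (4 * b))).
pose f v := [set F v i | i : 'I_b].
have fP v c : c \in f v -> exists2 i, i < b & c = phi v + i %[mod K].
  by case/imsetP=> i _ ->; exists i; rewrite //= modn_mod.
have dom x y c d : a x y -> c \in f x -> d \in f y ->
    exists2 r, 0 < r <= 2 * b & d = c + r %[mod K].
  move=> /ok axy /fP[i ib ci] /fP[j jb dj].
  have [e Ee] : exists e : bool, phi y = phi x + b + e %[mod K].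
    by case/orP: axy => /eqP E; [exists false|exists true]; rewrite ?addn0 ?addn1.
  exists (b + e + j - i); first by clear -ib jb; case: e; lia.
  rewrite dj -modnDml Ee modnDml -[RHS]modnDml ci modnDml.
  by congr (_ %% _); clear -ib jb; case: e; lia.
have no r c d : 0 < r < K -> d = c %[mod K] -> d = c + r %[mod K] -> False.
  move=> rK dc dcr; have : c + r == c + 0 %[mod K] by rewrite -dcr addn0 dc.
  by case/andP: rK => r0 rK; rewrite eqn_modDl mod0n modn_small // gtn_eqF.
exists f; split=> [v|].
  rewrite card_imset ?card_ord // => i j /(congr1 val) /= /eqP.
  rewrite eqn_modDl !modn_small => [/eqP /val_inj //||];
    exact: leq_trans (ltn_ord _) (leqW (leq_pmull _ _)).
split=> [x y axy|x y z w axy azw].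
  apply/eqP; rewrite setI_eq0 finset.disjoints_subset; apply/fintype.subsetP=> c cx.
  rewrite inE; apply/negP=> cy; have [r rb E] := dom _ _ _ _ axy cx cy.
  by apply: (no r c c) => //; clear -rb; rewrite /K; lia.
case/set0Pn=> c; rewrite inE => /andP[cx cw].
apply/eqP; rewrite setI_eq0 finset.disjoints_subset; apply/fintype.subsetP=> d dy.
rewrite inE; apply/negP=> dz; have [r rb E] := dom _ _ _ _ axy cx dy.
have [r' rb' E'] := dom _ _ _ _ azw dz cw.
apply: (no (r + r') c c) => //; first by clear -rb rb'; rewrite /K; lia.
by rewrite addnA -modnDml -E modnDml.
Qed.

End Labelling.

(** * Extending labellings over leaves and threads *)

Section Extension.
Variables (V : finType) (a : rel V).
Hypothesis ora : oriented a.
Implicit Types U : {set V}.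

Lemma uadj_sym : symmetric (uadj a).
Proof. by move=> x y; rewrite /uadj orbC. Qed.

Lemma uadj_irr : irreflexive (uadj a).
Proof. by move=> x; rewrite /uadj orbb; apply/negbTE; case: ora. Qed.

Lemma extend_leaf b U v (phi : V -> nat) : v \in U -> #|nbhd U (uadj a) v| <= 1 ->
  {in U :\ v &, forall x y, a x y -> step b (phi x) (phi y)} ->
  exists psi : V -> nat, {in U &, forall x y, a x y -> step b (psi x) (psi y)}.
Proof.
have [ai aa] := ora.
(* If [v] has no neighbour in [U], [w] is the default [v], and any label will do. *)
move=> vU dv ok; pose w := odflt v [pick w in nbhd U (uadj a) v].
have wP x : x \in U -> uadj a v x -> x = w.
  move=> xU vx; have xN : x \in nbhd U (uadj a) v by rewrite inE xU.
  rewrite /w; case: pickP => [y yN|/(_ x)]; last by rewrite xN.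
  by move/card_le1_eqP: dv; apply.
exists (fun u => if u == v then if a w v then phi w + b else phi w + 3 * b else phi u).
move=> x y xU yU axy; case: eqVneq => [xv|xv]; case: eqVneq => [yv|yv].
- by move: axy; rewrite xv yv (negPf (ai _)).
- have yw : y = w by apply: wP => //; rewrite /uadj -xv axy.
  rewrite yw in axy *; subst x; rewrite (negPf (aa _ _ axy)).
  by have := step_bwd b (phi w) false; rewrite addn0.
- have xw : x = w by apply: wP => //; rewrite /uadj -yv axy orbT.
  rewrite xw in axy *; subst y; rewrite axy.
  by have := step_fwd b (phi w) false; rewrite addn0.
by apply: ok; rewrite ?inE ?xv ?yv.
Qed.

(** The inner vertices have all their neighbours on the walk, so [interpolate_steps] relabels them
    between the fixed labels of the ends. The girth keeps these [4 * b + 2] vertices distinct, so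
    [index] recovers their positions. *)
Lemma extend_thread b U p g (phi : V -> nat) : girth_ge a g -> 4 * b + 2 <= g ->
  {in U, forall v, 1 < #|nbhd U (uadj a) v|} -> p \in darts U (uadj a) ->
  (forall i, 0 < i <= 4 * b -> #|nbhd U (uadj a) (walk U (uadj a) p i)| = 2) ->
  {in U :\: [set walk U (uadj a) p i.+1 | i : 'I_(4 * b)] &,
     forall x y, a x y -> step b (phi x) (phi y)} ->
  exists psi : V -> nat, {in U &, forall x y, a x y -> step b (psi x) (psi y)}.
Proof.
have [ai aa] := ora.
move=> girth bg deg2 pD thr; set I := [set _ | _ in _] => ok.
set w := walk U (uadj a) p in thr I ok.
have W := walkP deg2 pD; rewrite -/w in W.
have un : uniq (mkseq w (4 * b).+2).
  have := walk_uniq uadj_irr uadj_sym girth deg2 pD; rewrite -/w => /mkseq_uniqP inj.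
  by apply/mkseq_uniqP=> i j; rewrite !inE => ib jb; apply: inj; rewrite inE; apply: leq_trans bg; rewrite addn2.
have iw i : i <= (4 * b).+1 -> index (w i) (mkseq w (4 * b).+2) = i.
  move=> ib; have := @index_uniq _ (w 0) i (mkseq w (4 * b).+2).
  by rewrite size_mkseq nth_mkseq // => ->.
have inI i : i <= (4 * b).+1 -> (w i \in I) = (0 < i <= 4 * b).
  move=> ib; apply/imsetP/idP => [[j _ Ej]|].
    have : index (w i) (mkseq w (4 * b).+2) = j.+1.
      by rewrite Ej iw // ltnS ltnW.
    by rewrite iw // => ->; apply: ltn_ord.
  by case: i ib => // i ib /= il; exists (Ordinal il).
have [|x [x0 xm xs]] := @interpolate_steps b (4 * b).+1 (fun i => a (w i) (w i.+1))
   (phi (w 0)) (phi (w (4 * b).+1)); first exact: leqnSn.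
pose psi v := if v \in I then x (index v (mkseq w (4 * b).+2)) else phi v.
have psiw i : i <= (4 * b).+1 -> psi (w i) = x i %[mod (4 * b).+1].
  move=> ib; rewrite /psi inI // iw //; case: ifP => // H.
  case: i ib H => [_ _|i ib H]; first by rewrite x0.
  by have -> : i.+1 = (4 * b).+1 by lia.
have stepw i : i <= 4 * b -> (a (w i) (w i.+1) -> step b (psi (w i)) (psi (w i.+1))) /\
    (a (w i.+1) (w i) -> step b (psi (w i.+1)) (psi (w i))).
  move=> ib; have := xs i.
  split=> A; rewrite (step_mod (psiw _ _) (psiw _ _)) ?ltnS //; try exact: leqW.
    by move: (xs i); rewrite A.
  by move: (xs i); rewrite (negPf (aa _ _ A)).
have nbw u v : u \in I -> v \in U -> uadj a u v ->
    exists2 i, i <= 4 * b & (u = w i /\ v = w i.+1) \/ (u = w i.+1 /\ v = w i).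
  case/imsetP=> i _ -> vU uv; have ib := ltn_ord i.
  have [wU e1 n1] := W i; have [wU1 e2 _] := W i.+1; have [wU2 _ _] := W i.+2.
  have : v \in nbhd U (uadj a) (w i.+1) by rewrite inE vU.
  rewrite (nbhd2_eq _ _ _ n1) ?inE ?wU ?wU2 ?e2 ?(uadj_sym (w i.+1) (w i)) ?e1 //; last by apply: thr.
  case/orP=> /eqP->; [exists i; [exact: ltnW|by right]|exists i.+1; [by []|by left]].
exists psi => u v uU vU auv.
have [uI|uI] := boolP (u \in I).
  have [|i ib] := nbw u v uI vU; first by rewrite /uadj auv.
  by have [h1 h2] := stepw i ib; case=> -[Eu Ev]; move: auv; rewrite Eu Ev.
have [vI|vI] := boolP (v \in I).
  have [|i ib] := nbw v u vI uU; first by rewrite /uadj auv orbT.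
  by have [h1 h2] := stepw i ib; case=> -[Eu Ev]; move: auv; rewrite Eu Ev.
by rewrite /psi (negPf uI) (negPf vI); apply: ok; rewrite // !inE ?uI ?vI.
Qed.

Lemma high_girth_labelling b t k g : 0 < b -> girth_ge a g ->
  2 ^ t * (3 * (4 * b)) <= 2 ^ k -> 6 * 5 ^ k < g -> 4 * b + 2 <= g ->
  ~ clique_minor t [set: V] (uadj a) ->
  exists phi : V -> nat, forall x y, a x y -> step b (phi x) (phi y).
Proof.
move=> b0 girth tk kg bg nominor.
suff H n U : #|U| < n -> exists phi : V -> nat,
    {in U &, forall x y, a x y -> step b (phi x) (phi y)}.
  have [phi ok] := H #|[set: V]|.+1 [set: V] (ltnSn _).
  by exists phi => x y; apply: ok; rewrite inE.
elim: n U => // n IH U Un.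
have [->|U0] := eqVneq U finset.set0.
  by exists (fun=> 0) => x y; rewrite inE.
have [[v vU dv]|H] := boolp.pselect (exists2 v, v \in U & #|nbhd U (uadj a) v| <= 1).
  have [|phi ok] := IH (U :\ v); first by move: Un; rewrite (cardsD1 v U) vU.
  exact: extend_leaf vU dv ok.
have deg2 : {in U, forall v, 1 < #|nbhd U (uadj a) v|}.
  by move=> v vU; rewrite ltnNge; apply/negP=> dv; apply: H; exists v.
have [|p pD thr] := thread_or_minor uadj_sym uadj_irr girth deg2 U0 tk kg.
  by move=> cm; apply/nominor/(clique_minor_sub _ cm)/finset.subsetT.
have [|phi ok] := IH (U :\: [set walk U (uadj a) p i.+1 | i : 'I_(4 * b)]).
  apply: leq_trans (_ : #|U| <= n) => //; apply: proper_card; rewrite properE subsetDl.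
  apply/subsetPn; exists (walk U (uadj a) p 1).
    by have [] := walkP deg2 pD 1.
  (* Since [b] is positive the thread is not empty, and the induction descends. *)
  have b4 : 0 < 4 * b by rewrite muln_gt0 b0.
  rewrite inE negb_and negbK; apply/orP; left; apply/imsetP.
  by exists (Ordinal b4).
exact: (extend_thread girth bg deg2 pD thr ok).
Qed.

End Extension.

(** * Crossing parities exclude K5 *)

Lemma addb_xorb a b : a (+) b = xorb a b.
Proof. by case: a; case: b. Qed.

Section CrossingSystem.
(** In the application, [X x y w] is the parity of the crossings of the edge [xy] with the vertical
    ray above [w], and [L x y] says that [x] lies to the left of [y]. *)
Variables (V : finType) (e : rel V) (X : V -> V -> V -> bool) (L : rel V).
Hypothesis antiL : forall x y, x != y -> L x y = ~~ L y x.
Hypothesis crossX : forall x y z w, e x y -> e z w ->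
  x != z -> x != w -> y != z -> y != w ->
  X x y z (+) X x y w (+) (X z w x (+) X z w y) = L x z (+) L x w (+) (L y z (+) L y w).

Fixpoint chain x (p : seq V) w :=
  if p is y :: p' then X x y w (+) chain y p' w else false.

(** The relation [crossX] telescopes along the path: terms at inner vertices occur twice and
    cancel. *)
Lemma chain_edge x p z w : path e x p -> e z w -> z \notin x :: p -> w \notin x :: p ->
  chain x p z (+) chain x p w (+) (X z w x (+) X z w (last x p)) =
  L x z (+) L x w (+) (L (last x p) z (+) L (last x p) w).
Proof.
move=> + ezw; elim: p x => [|y p IH] x /=; first by rewrite !addbb.
case/andP=> exy py; rewrite !(inE, negb_or) => /and3P[zx zy zp] /and3P[wx wy wp].
have := IH y py; rewrite !inE !negb_or zy wy => /(_ zp wp) E1.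
have := crossX exy ezw; rewrite !(eq_sym _ z) !(eq_sym _ w) => /(_ zx wx zy wy) E2.
transitivity ((X x y z (+) X x y w (+) (X z w x (+) X z w y)) (+)
  (chain y p z (+) chain y p w (+) (X z w y (+) X z w (last y p)))).
  by rewrite !addb_xorb; btauto.
by rewrite E1 E2 !addb_xorb; btauto.
Qed.

Lemma chain_chain x p z q : path e x p -> path e z q ->
  {in x :: p, forall u, u \notin z :: q} ->
  chain x p z (+) chain x p (last z q) (+) (chain z q x (+) chain z q (last x p)) =
  L x z (+) L x (last z q) (+) (L (last x p) z (+) L (last x p) (last z q)).
Proof.
move=> px; elim: q z => [|y q IH] z /=; first by rewrite !addbb.
case/andP=> ezy py dis.
have dis' : {in x :: p, forall u, u \notin y :: q}.
  by move=> u /dis; rewrite !(inE, negb_or) => /and3P[_ -> ->].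
have E1 := IH y py dis'.
have zn : z \notin x :: p by apply/negP=> /dis; rewrite inE eqxx.
have yn : y \notin x :: p by apply/negP=> /dis; rewrite !inE eqxx orbT.
have E2 := chain_edge px ezy zn yn.
transitivity ((chain x p z (+) chain x p y (+) (X z y x (+) X z y (last x p))) (+)
  (chain x p y (+) chain x p (last y q) (+) (chain y q x (+) chain y q (last x p)))).
  by rewrite !addb_xorb; btauto.
by rewrite E1 E2 !addb_xorb; btauto.
Qed.

Lemma connected_in_path (B : {set V}) x y : connected_in e B -> x \in B -> y \in B ->
  exists p, [/\ path e x p, last x p = y & {subset x :: p <= B}].
Proof.
move=> Bc xB yB; have /connectP[p pp ->] := Bc x y xB yB; exists p.
elim: p x xB pp {yB} => [|z p IH] x xB /=; first by split=> // u /[1!inE] /eqP->.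
case/andP=> /and3P[_ zB exz] pp; have [h1 h2 h3] := IH z zB pp.
split=> //; first by rewrite exz.
by move=> u; rewrite inE => /orP[/eqP->|/h3].
Qed.

(* Summing the crossing relation over the 15 pairs of disjoint edges of K5:
   every chain occurs twice, whereas the number of interleaving pairs is odd. *)
Theorem no_K5_minor : ~ clique_minor 5 [set: V] e.
Proof.
case=> B [HB1 HB2].
have [r rB] : exists r : nat -> V, forall i, i < 5 -> r i \in B i.
  have [_ /set0Pn[x0 _] _] := HB1 0 isT.
  exists (fun i => odflt x0 [pick x in B i]) => i /HB1[_ /set0Pn[x xB] _].
  by case: pickP => //= /(_ x); rewrite xB.
(* The path of a pair stays in its two branch sets, so paths of disjoint pairs share no vertex. *)
have /boolp.choice[P PP] (ij : nat * nat) : exists p, ij.1 < ij.2 < 5 ->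
    [/\ path e (r ij.1) p, last (r ij.1) p = r ij.2 &
       {subset r ij.1 :: p <= B ij.1 :|: B ij.2}].
  case: ij => i j /=; have [/andP[ij j5]|_] := boolP (i < j < 5); last by exists [::].
  have i5 := ltn_trans ij j5.
  have [_ [u [v [uB vB euv]]]] := HB2 i j ij j5.
  have [_ _ Bi] := HB1 i i5; have [_ _ Bj] := HB1 j j5.
  have [p [p1 p2 p3]] := connected_in_path Bi (rB i i5) uB.
  have [q [q1 q2 q3]] := connected_in_path Bj vB (rB j j5).
  exists (p ++ v :: q) => _; split.
  - by rewrite cat_path p1 p2 /= euv.
  - by rewrite last_cat /= q2.
  by move=> w; rewrite -cat_cons mem_cat => /orP[/p3|/q3] wB; rewrite inE wB ?orbT.
pose Y i j k := chain (r i) (P (i, j)) (r k).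
pose M i k := L (r i) (r k).
have disB i j x : i < 5 -> j < 5 -> i != j -> x \in B i -> x \notin B j.
  move=> i5 j5; case: ltngtP => // ij _ xB.
    by rewrite (disjointFr (HB2 _ _ ij j5).1).
  by rewrite (disjointFl (HB2 _ _ ij i5).1).
have antiM i k : i < 5 -> k < 5 -> i != k -> M i k = ~~ M k i.
  move=> i5 k5 ik; apply: antiL; apply: contraTneq (rB i i5) => ->.
  by apply: (disB k); rewrite ?rB // eq_sym.
pose Z i j k l := Y i j k (+) Y i j l (+) (Y k l i (+) Y k l j) (+)
  (M i k (+) M i l (+) (M j k (+) M j l)).
have R i j k l : i < j < 5 -> k < l < 5 -> uniq [:: i; j; k; l] -> Z i j k l = false.
  move=> ij kl un; have [p1 p2 p3] := PP (i, j) ij; have [q1 q2 q3] := PP (k, l) kl.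
  rewrite /Z /Y /M; have := chain_chain p1 q1; rewrite p2 q2 /= => ->; first by rewrite addbb.
  move=> u /p3 uij; apply/negP=> /q3 ukl; move: ij kl un uij ukl.
  rewrite /= !inE !negb_or => /andP[ij j5] /andP[kl l5] /and3P[/and3P[_ ik il] /andP[jk jl] _].
  have i5 := ltn_trans ij j5; have k5 := ltn_trans kl l5.
  by case/orP=> uB; rewrite !(negPf (disB _ _ _ _ _ _ uB)).
have : Z 0 1 2 3 (+) Z 0 1 2 4 (+) Z 0 1 3 4 (+) Z 0 2 1 3 (+) Z 0 2 1 4 (+)
    Z 0 2 3 4 (+) Z 0 3 1 2 (+) Z 0 3 1 4 (+) Z 0 3 2 4 (+) Z 0 4 1 2 (+)
    Z 0 4 1 3 (+) Z 0 4 2 3 (+) Z 1 2 3 4 (+) Z 1 3 2 4 (+) Z 1 4 2 3 = true.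
  rewrite /Z (antiM 2 1) // (antiM 3 1) // (antiM 3 2) // (antiM 4 1) // (antiM 4 2) // (antiM 4 3) //.
  by rewrite !addb_xorb; btauto.
by rewrite !R.
Qed.

End CrossingSystem.

(** * Crossing parities of polygonal lines *)

Section DiscreteCrossing.
Local Open Scope ring_scope.
Variable R : realFieldType.
Implicit Types (p q : R * R) (u v : nat -> R * R) (m : R).

(* The half plane x < 0 together with the open negative y-axis, so that
   exactly one of p, - p lies in it when p != 0. *)
Definition left_half p := (p.1 < 0) || ((p.1 == 0) && (p.2 < 0)).

Definition far m p := (m <= `|p.1|) || (m <= `|p.2|).

Definition close m p q := (`|p.1 - q.1| < m) && (`|p.2 - q.2| < m).

(* For far and close points, tells whether [p, q] crosses the upper y-axis. *)
Definition crosses p q := (left_half p (+) left_half q) && (0 < p.2).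

Fixpoint crossing_parity u n :=
  if n is n'.+1 then crossing_parity u n' (+) crosses (u n') (u n) else false.

Lemma left_halfN p : p != 0 -> left_half (- p) = ~~ left_half p.
Proof.
case: p => x y; rewrite /left_half xpair_eqE /= oppr_lt0 oppr_eq0.
by case: (ltrgtP x 0) => //= _; rewrite ?oppr_lt0; case: (ltrgtP y 0).
Qed.

(** Points on different sides have abscissae smaller than [m] in absolute value, so both ordinates
    are at least [m] in absolute value; being close, these share their sign. *)
Lemma close_far_sign m p q : far m p -> far m q -> close m p q ->
  left_half p != left_half q ->
  [/\ (0 < p.2) = (0 < q.2), (p.2 < 0) = ~~ (0 < p.2) & (q.2 < 0) = ~~ (0 < q.2)].
Proof.
case: p q => x y [z w]; rewrite /far /close /left_half /=.
rewrite !ler_normr !ltr_norml => fp fq /andP[/andP[h1 h2] /andP[h3 h4]] ne.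
have sg : (x <= 0 /\ 0 <= z) \/ (z <= 0 /\ 0 <= x).
  move: ne; case: (ltrgtP x 0) => hx; case: (ltrgtP z 0) => hz //= _;
    by [left; split; lra|right; split; lra].
have nx : (m <= x) || (m <= - x) = false by apply/negbTE; rewrite negb_or; apply/andP; split; rewrite -ltNge; lra.
have nz : (m <= z) || (m <= - z) = false by apply/negbTE; rewrite negb_or; apply/andP; split; rewrite -ltNge; lra.
move: fp fq; rewrite nx nz /= => fp fq.
have m0 : 0 < m by lra.
case/orP: fp => fp; case/orP: fq => fq; try (exfalso; lra).
  have y0 : 0 < y by lra. have w0 : 0 < w by lra.
  by rewrite y0 w0 !ltNge !ltW.
have y0 : y < 0 by lra. have w0 : w < 0 by lra.
by rewrite y0 w0 !ltNge !ltW.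
Qed.

(** Discrete homotopy invariance: a small closed quadrilateral far from the origin crosses the upper
    axis an even number of times. *)
Lemma crosses_cell m p q r s : far m p -> far m q -> far m r -> far m s ->
  close m p q -> close m p r -> close m p s -> close m q r -> close m q s -> close m r s ->
  crosses p q (+) crosses r s = crosses p r (+) crosses q s.
Proof.
move=> fp fq fr fs pq pr ps qr qs rs; rewrite /crosses.
have sign x y : far m x -> far m y -> close m x y ->
    (left_half x == left_half y) || ((0 < x.2) == (0 < y.2)).
  by move=> fx fy xy; case: eqP => //= /eqP /(close_far_sign fx fy xy)[-> _ _].
move: (sign _ _ fp fq pq) (sign _ _ fp fr pr) (sign _ _ fp fs ps).
move: (sign _ _ fq fr qr) (sign _ _ fq fs qs) (sign _ _ fr fs rs).
move: (left_half p) (left_half q) (left_half r) (left_half s).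
by move: (0 < p.2) (0 < q.2) (0 < r.2) (0 < s.2); do 8!case.
Qed.

(** Negation exchanges the upper and lower half-axes, and a change of side crosses exactly one of
    them. *)
Lemma crosses_opp m p q : 0 < m -> far m p -> far m q -> close m p q ->
  crosses (- p) (- q) = crosses p q (+) (left_half p (+) left_half q).
Proof.
move=> m0 fp fq pq; have nz r : far m r -> r != 0.
  by apply: contraTneq => ->; rewrite /far normr0 orbb -ltNge.
rewrite /crosses !left_halfN ?nz // addbN addNb negbK /= oppr_gt0.
have := close_far_sign fp fq pq.
by case: (left_half p); case: (left_half q) => //= /(_ isT)[_ -> _]; case: (0 < _).
Qed.

Lemma crossing_parity_strip u v n :
  (forall j, (j < n)%N -> crosses (u j) (u j.+1) (+) crosses (v j) (v j.+1) =
     crosses (u j) (v j) (+) crosses (u j.+1) (v j.+1)) ->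
  crossing_parity u n (+) crossing_parity v n =
  crosses (u 0%N) (v 0%N) (+) crosses (u n) (v n).
Proof.
elim: n => [|n IH] H /=; first by rewrite addbb.
rewrite addbACA IH ?H //; last by move=> j jn; apply: H; apply: ltnW.
by rewrite addbA -[X in X (+) _]addbA addbb addbF.
Qed.

Lemma crossing_parity_grid (D : nat -> nat -> R * R) k n :
  (forall i j, (i < k)%N -> (j < n)%N ->
     crosses (D i j) (D i j.+1) (+) crosses (D i.+1 j) (D i.+1 j.+1) =
     crosses (D i j) (D i.+1 j) (+) crosses (D i j.+1) (D i.+1 j.+1)) ->
  crossing_parity (D 0%N) n (+) crossing_parity (D k) n =
  crossing_parity (D^~ 0%N) k (+) crossing_parity (D^~ n) k.
Proof.
elim: k => [|k IH] H; first by rewrite addbb.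
have S := crossing_parity_strip (fun j jn => H k j (ltnSn k) jn).
have {}IH := IH (fun i j ik jn => H i j (leqW ik) jn).
transitivity ((crossing_parity (D 0%N) n (+) crossing_parity (D k) n) (+)
  (crossing_parity (D k) n (+) crossing_parity (D k.+1) n)).
  by rewrite !addb_xorb; btauto.
by rewrite IH S /= !addb_xorb; btauto.
Qed.

Lemma crossing_parity_opp m u n : 0 < m ->
  (forall i, (i <= n)%N -> far m (u i)) ->
  (forall i, (i < n)%N -> close m (u i) (u i.+1)) ->
  crossing_parity (fun i => - u i) n =
  crossing_parity u n (+) (left_half (u 0%N) (+) left_half (u n)).
Proof.
move=> m0; elim: n => [|n IH] fu cu /=; first by rewrite addbb.
rewrite IH; [|by move=> i ?; apply: fu; apply: leqW|by move=> i ?; apply: cu; apply: leqW].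
rewrite (crosses_opp m0 (fu n (leqnSn n)) (fu n.+1 (leqnn _)) (cu n (ltnSn n))).
by rewrite !addb_xorb; btauto.
Qed.

(* [crosses_cell] summed over the grid of the differences q j - p i, whose four
   sides are the two lines seen from each other's end points. *)
Lemma crossing_parity_ends m (p q : nat -> R * R) n : 0 < m ->
  (forall i j, (i <= n)%N -> (j <= n)%N -> far m (q j - p i)) ->
  (forall i, (i < n)%N -> close (m / 2) (p i) (p i.+1)) ->
  (forall i, (i < n)%N -> close (m / 2) (q i) (q i.+1)) ->
  crossing_parity (fun i => p i - q 0%N) n (+) crossing_parity (fun i => p i - q n) n (+)
  (crossing_parity (fun j => q j - p 0%N) n (+) crossing_parity (fun j => q j - p n) n) =
  left_half (p 0%N - q 0%N) (+) left_half (p 0%N - q n) (+)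
  (left_half (p n - q 0%N) (+) left_half (p n - q n)).
Proof.
move=> m0 fD cp cq; pose D i j := q j - p i.
have cl a b a' b' : close (m / 2) a a' \/ a = a' -> close (m / 2) b b' \/ b = b' ->
    close m (b - a) (b' - a').
  rewrite /close !ltr_norml; case: a b a' b' => [a1 a2] [b1 b2] [a1' a2'] [b1' b2'] /=.
  case=> [/andP[/andP[? ?] /andP[? ?]]|[? ?]]; case=> [/andP[/andP[? ?] /andP[? ?]]|[? ?]];
  subst; apply/andP; split; apply/andP; split; lra.
have G : crossing_parity (D 0%N) n (+) crossing_parity (D n) n =
  crossing_parity (D^~ 0%N) n (+) crossing_parity (D^~ n) n.
  apply: crossing_parity_grid => i j ik jn.
  have cpi := cp i ik; have cqj := cq j jn.
  have cpi' : close (m / 2) (p i.+1) (p i).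
    by move: cpi; rewrite /close !(distrC (p i).1) !(distrC (p i).2).
  have cqj' : close (m / 2) (q j.+1) (q j).
    by move: cqj; rewrite /close !(distrC (q j).1) !(distrC (q j).2).
  by apply: (@crosses_cell m); rewrite /D ?fD ?(ltnW ik) ?(ltnW jn) //; apply: cl; tauto.
(* Turning [q j - p i] into [p i - q j] on two sides of the grid produces the [left_half] terms of
   the conclusion. *)
have opp j : (j <= n)%N -> crossing_parity (D^~ j) n = crossing_parity (fun i => p i - q j) n
    (+) (left_half (p 0%N - q j) (+) left_half (p n - q j)).
  move=> jn; have <- : crossing_parity (fun i => - (p i - q j)) n = crossing_parity (D^~ j) n.
    by elim: (n) => //= k ->; rewrite /D !opprB.
  apply: (crossing_parity_opp m0) => i ik.
    have := fD i j ik jn; rewrite /far -opprB /= !normrN //.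
  have := cl _ (q j) _ (q j) (or_introl (cp i ik)) (or_intror erefl).
  by rewrite /close -!(opprB (p _) (q j)) /= -!opprD !normrN.
rewrite -/(D 0%N) -/(D n) G !opp //.
move: (crossing_parity (fun i => p i - q 0%N) n) (crossing_parity (fun i => p i - q n) n).
move=> a b; rewrite !addb_xorb; btauto.
Qed.

End DiscreteCrossing.

(** * Curves in the plane *)

Section Sampling.
Local Open Scope ring_scope.
Local Open Scope classical_set_scope.
Import numFieldNormedType.Exports.

Lemma itv_uniform_continuity (R : realType) (c : R -> R * R) (d : R) : 0 < d ->
  {within `[0, 1], continuous c} ->
  \forall n \near \oo, forall s t : R, 0 <= s <= 1 -> 0 <= t <= 1 ->
    `|s - t| <= n.+1%:R^-1 -> ball (c s) d (c t).
Proof.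
move=> d0 /subspace_continuousP cc.
have d2 : 0 < d / 2 by rewrite divr_gt0.
have /compact_near_coveringP := @segment_compact R 0 1.
move=> /(_ nat \oo (fun n s => forall t, 0 <= t <= 1 -> 0 <= s <= 1 ->
   `|s - t| <= n.+1%:R^-1 -> ball (c s) d (c t)) _) H.
suff H' : \forall n \near \oo, forall s, `[0, 1] s -> forall t, 0 <= t <= 1 ->
    0 <= s <= 1 -> `|s - t| <= n.+1%:R^-1 -> ball (c s) d (c t).
  by apply: filterS H' => n H' s t sI tI; apply: H' => //; rewrite /= in_itv.
apply: H => s0 s0I.
  have /cvg_ballP/(_ _ d2) := cc s0 s0I.
  rewrite /within /= => /nbhs_ballP[r /= r0 Hr].
  have r2 : 0 < r / 2 by rewrite divr_gt0.
  exists (ball s0 (r / 2), [set n : nat | n.+1%:R^-1 < r / 2]) => /=.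
    split; first exact: nbhsx_ballx.
    have := near_infty_natSinv_lt (PosNum r2).
    by apply: filterS.
  move=> [s n] /= [Hs Hn] t tI sI st.
  have st0 : `|s0 - t| < r.
    rewrite -(subrKA s) (splitr r); apply: le_lt_trans (ler_normD _ _) _.
    by apply: ltrD => //; apply: le_lt_trans Hn.
  apply: (@ball_splitr _ _ (c s0)); apply: Hr; rewrite /= ?in_itv //.
  by apply: lt_le_trans Hs _; move: r0; lra.
Qed.

(** The differences of points of the two curves form a compact, hence closed, set missing 0. The
    ball around 0 that it avoids is a square, whence the disjunction. *)
Lemma disjoint_compact_gap (R : realType) (c d : R -> R * R) :
  {within `[0, 1], continuous c} -> {within `[0, 1], continuous d} ->
  (forall s t : R, 0 <= s <= 1 -> 0 <= t <= 1 -> c s <> d t) ->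
  exists2 m : R, 0 < m & forall s t : R, 0 <= s <= 1 -> 0 <= t <= 1 ->
    (m <= `|(d t - c s).1|) || (m <= `|(d t - c s).2|).
Proof.
move=> cc cd dis.
have Kc : compact (c @` `[0, 1]) by apply: continuous_compact cc (@segment_compact _ _ _).
have Kd : compact (d @` `[0, 1]) by apply: continuous_compact cd (@segment_compact _ _ _).
pose f (x : (R * R) * (R * R)) : R * R := x.2 - x.1.
have cf : continuous f.
  by move=> x; apply: cvgB; [exact: cvg_snd|exact: cvg_fst].
have Kf : compact (f @` (c @` `[0, 1] `*` d @` `[0, 1])).
  apply: continuous_compact; last exact: compact_setX.
  exact: continuous_subspaceT.
have /closed_openC := compact_closed (@norm_hausdorff _ _) Kf.
rewrite openE => H.
have /H/nbhs_ballP[m /= m0 Hm] : (~` (f @` (c @` `[0, 1] `*` d @` `[0, 1]))) 0.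
  move=> [[p q] /= [[s + <-] [t + <-]]] /eqP; rewrite !in_itv /= => sI tI.
  by rewrite /f /= subr_eq0 => /eqP /esym; apply: dis.
exists m => // s t sI tI; rewrite !leNgt -negb_and; apply/negP=> /andP[h1 h2].
apply: (Hm (d t - c s)); last by exists (c s, d t) => //; split; [exists s|exists t]; rewrite //= in_itv.
by split; rewrite /ball /= sub0r normrN.
Qed.

End Sampling.

(** * From plane drawings to a crossing system *)

Section Planar.
Local Open Scope ring_scope.
Local Open Scope classical_set_scope.
Import numFieldNormedType.Exports.

Definition sample (R : realType) (c : R -> R * R) n i := c (i%:R / n.+1%:R).

Lemma crossing_parity_curves (R : realType) (c d : R -> R * R) :
  {within `[0, 1], continuous c} -> {within `[0, 1], continuous d} ->
  (forall s t : R, 0 <= s <= 1 -> 0 <= t <= 1 -> c s <> d t) ->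
  \forall n \near \oo,
    crossing_parity (fun i => sample c n i - d 0) n.+1 (+)
    crossing_parity (fun i => sample c n i - d 1) n.+1 (+)
    (crossing_parity (fun j => sample d n j - c 0) n.+1 (+)
     crossing_parity (fun j => sample d n j - c 1) n.+1) =
    left_half (c 0 - d 0) (+) left_half (c 0 - d 1) (+)
    (left_half (c 1 - d 0) (+) left_half (c 1 - d 1)).
Proof.
move=> cc cd dis; have [m m0 gap] := disjoint_compact_gap cc cd dis.
have m2 : 0 < m / 2 by rewrite divr_gt0.
apply: filterS2 (itv_uniform_continuity m2 cc) (itv_uniform_continuity m2 cd) => n uc ud.
have sI i : (i <= n.+1)%N -> 0 <= (i%:R / n.+1%:R : R) <= 1.
  move=> iN; apply/andP; split; first by rewrite divr_ge0 ?ler0n.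
  by rewrite ler_pdivrMr ?ltr0n // mul1r ler_nat.
have s1 i : `|(i%:R / n.+1%:R : R) - i.+1%:R / n.+1%:R| <= n.+1%:R^-1.
  by rewrite -mulrBl -natr1 opprD addNKr mulN1r normrN ger0_norm ?invr_ge0.
have E0 (f : R -> R * R) : sample f n 0 = f 0 by rewrite /sample mul0r.
have E1 (f : R -> R * R) : sample f n n.+1 = f 1 by rewrite /sample divff ?pnatr_eq0.
rewrite -(E0 c) -(E0 d) -(E1 c) -(E1 d); apply: (@crossing_parity_ends _ m) => //.
- by move=> i j iN jN; apply: gap; apply: sI.
- move=> i iN; have [h1 h2] := uc _ _ (sI i (ltnW iN)) (sI i.+1 iN) (s1 i).
  by rewrite /close h1 h2.
- move=> i iN; have [h1 h2] := ud _ _ (sI i (ltnW iN)) (sI i.+1 iN) (s1 i).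
  by rewrite /close h1 h2.
Qed.

Theorem planar_no_K5_minor (V : finType) (a : rel V) : oriented a -> planar a ->
  ~ clique_minor 5 [set: V]%SET (uadj a).
Proof.
move=> ora [pos [c [pos_inj [curve disj]]]].
pose par n x y w := crossing_parity (fun i => sample (c x y) n i - pos w) n.+1.
pose L : rel V := fun x y => left_half (pos x - pos y).
(* There are finitely many pairs of arcs, so one sampling is fine enough for all. *)
have /filter_ex[n rel] : \forall n \near \oo, forall x y z w, a x y -> a z w ->
    x != z -> x != w -> y != z -> y != w ->
    par n x y z (+) par n x y w (+) (par n z w x (+) par n z w y) =
    L x z (+) L x w (+) (L y z (+) L y w).
  apply: filter_forall => x; apply: filter_forall => y.
  apply: filter_forall => z; apply: filter_forall => w.
  have [axy|] := boolP (a x y); last by move=> _; apply: nearW.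
  have [azw|] := boolP (a z w); last by move=> _; apply: nearW.
  have [xz|] := boolP (x != z); last by move=> _; apply: nearW.
  have [xw|] := boolP (x != w); last by move=> _; apply: nearW.
  have [yz|] := boolP (y != z); last by move=> _; apply: nearW.
  have [yw|] := boolP (y != w); last by move=> _; apply: nearW.
  have [cxy [_ [cxy0 [cxy1 cxyP]]]] := curve x y axy.
  have [czw [_ [czw0 [czw1 czwP]]]] := curve z w azw.
  have ends (t : Rline) : 0 <= t <= 1 -> [\/ t = 0, t = 1 | 0 < t < 1].
    case/andP; rewrite !le_eqVlt => /predU1P[<-|t0]; first by constructor 1.
    by case/predU1P=> [->|t1]; [constructor 2|constructor 3; rewrite t0].
  have np u v : u != v -> pos u <> pos v by move=> /eqP uv /pos_inj.
  have dis (s t : Rline) : 0 <= s <= 1 -> 0 <= t <= 1 -> c x y s <> c z w t.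
    move=> /ends sI /ends tI.
    case: sI => [->|->|sI]; case: tI => [->|->|tI]; rewrite ?cxy0 ?cxy1 ?czw0 ?czw1;
      try exact: np; try exact: cxyP; try exact: (nesym (czwP _ _ _)).
    by apply: disj => // -[xz' _]; move: xz; rewrite xz' eqxx.
  have := crossing_parity_curves cxy czw dis; apply: filterS => n.
  by rewrite cxy0 cxy1 czw0 czw1.
(* An undirected edge is read along its only arc, so [X] is symmetric on edges. *)
pose X x y w := if a x y then par n x y w else par n y x w.
apply: (@no_K5_minor _ _ X L) => [x y xy|x y z w].
  rewrite /L -opprB left_halfN //; apply: contra_neq xy => /eqP.
  by rewrite subr_eq0 => /eqP /pos_inj ->.
have [_ aa] := ora.
have XE u v : a u v -> X u v = par n u v /\ X v u = par n u v.
  by move=> auv; rewrite /X auv (negPf (aa _ _ auv)).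
move=> /orP[axy|ayx] /orP[azw|awz] xz xw yz yw.
- by have [-> _] := XE _ _ axy; have [-> _] := XE _ _ azw; apply: rel.
- have [-> _] := XE _ _ axy; have [_ ->] := XE _ _ awz.
  by rewrite (addbC (par n x y z)) (addbC (L x z)) (addbC (L y z)); apply: rel.
- have [_ ->] := XE _ _ ayx; have [-> _] := XE _ _ azw.
  by rewrite (addbC (par n z w x)) [RHS]addbC; apply: rel.
have [_ ->] := XE _ _ ayx; have [_ ->] := XE _ _ awz.
rewrite (addbC (par n w z x)) [RHS]addbC.
by rewrite (addbC (par n y x z)) (addbC (L x z)) (addbC (L y z)); apply: rel.
Qed.

End Planar.

(** * Directed cycles *)

Section IntersectionPattern.

(* s d tells whether two colour sets at distance d along the cycle meet. *)
Section Halving.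
Variable s : nat -> bool.
Hypotheses (s0 : s 0) (s1 : ~~ s 1) (sy : forall d, s d -> ~~ s d.+2)
  (sn : forall d, ~~ s d -> ~~ s d.+1 -> s d.+2)
  (sK : forall x y z, ~~ s x -> ~~ s (x + y) -> ~~ s (x + y + z) ->
     ~~ s y -> ~~ s z -> ~~ s (y + z) -> False).

(** Equivalently, the even extension of [s] to the integers has period [h]. *)
Definition dihedral h := (forall d, s (d + h) = s d) /\ (forall d, d <= h -> s (h - d) = s d).

(** Reflection about [h] gives [h - 1] and [h + 1] the same value, false by [sy], so [s h] holds by
    [sn]. Thus [s] starts at [h] as it does at 0, and the rules propagate the agreement. *)
Lemma dihedral_half h : 2 <= h -> dihedral (2 * h) -> dihedral h.
Proof.
move=> h2 [per refl].
have refl' d : d <= h -> s (h + d) = s (h - d).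
  by move=> dh; rewrite -(refl (h - d)); [congr s|]; clear -dh h2; lia.
have nh1 : ~~ s h.+1.
  apply/negP=> H; have : s (h - 1) by rewrite -refl' ?addn1 // (leq_trans _ h2).
  by move/sy; rewrite subn1 prednK ?H // (leq_trans _ h2).
have nh1' : ~~ s (h - 1) by rewrite -refl' ?addn1 // (leq_trans _ h2).
have sh : s h.
  apply: contraR nh1 => nh; have := sn nh1'.
  by rewrite subn1 prednK ?(leq_trans _ h2) //; apply.
have nh2 : ~~ s h.+2 by apply: sy.
have nh2' : ~~ s (h - 2) by rewrite -refl' ?addn2.
have H d : s (h + d) = s d /\ s (h + d.+1) = s d.+1.
  elim: d => [|d [IH1 IH2]].
    by rewrite addn0 addn1 sh s0 (negPf nh1) (negPf s1).
  split=> //; have [sd|nsd] := boolP (s d).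
    rewrite (negPf (sy sd)); have := sy (etrans IH1 sd).
    by rewrite -!addnS => /negPf.
  have [sd1|nsd1] := boolP (s d.+1); last first.
    rewrite (sn nsd nsd1); have := @sn (h + d); rewrite IH1 -!addnS IH2.
    exact.
  (* Here [sy] and [sn] leave [d.+2] open; a disagreement between [d.+2] and [h + d.+2] yields four
     pairwise disjoint sets, against [sK]. *)
  have nd3 := sy sd1; have nhd3 := sy (etrans IH2 sd1).
  have [sd2|nsd2] := boolP (s d.+2).
    apply/negPn/negP=> nhd2; have nd4 := sy sd2.
    have e1 : d.+4 + (h - 2) = h + d.+2 by clear -h2; lia.
    have e2 : h + d.+2 + 1 = (h + d.+1).+2 by clear; lia.
    have e3 : h - 2 + 1 = h - 1 by clear -h2; lia.
    by apply: (@sK d.+4 (h - 2) 1); rewrite ?e1 ?e2 ?e3.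
  apply/negP=> shd2; have nhd4 := sy shd2.
  have e1 : d.+2 + 1 = d.+3 by rewrite addn1.
  have e2 : d.+3 + h.+1 = (h + d.+2).+2 by clear; lia.
  by apply: (@sK d.+2 1 h.+1); rewrite ?e1 ?e2 ?add1n.
split=> [d|d dh]; first by rewrite addnC; have [] := H d.
by have [<- _] := H (h - d); rewrite -(refl d); [congr s|]; clear -dh h2; lia.
Qed.

Lemma no_dihedral_pow2 n : ~ dihedral (2 ^ n.+2).
Proof.
elim: n => [|n IH] D; last first.
  apply: IH; apply: dihedral_half; last by rewrite -expnS.
  by rewrite expnS leq_pmulr // expn_gt0.
have [_ /(_ 1 isT)] := D; rewrite (negPf s1) => s3.
by have := sn s1 (sy s0); rewrite (s3 : s 3 = false).
Qed.

End Halving.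

Variables (r : nat) (I : rel nat).
Hypotheses (r0 : 0 < r) (Irefl : reflexive I) (Isym : symmetric I)
  (Iper : forall i j, I (i + r) j = I i j)
  (Ianti : forall i j, I i j.+1 -> ~~ I i.+1 j)
  (IK4 : forall i j k l, ~~ I i j -> ~~ I i k -> ~~ I i l ->
     ~~ I j k -> ~~ I j l -> ~~ I k l -> False).

Lemma Idist1 i : ~~ I i i.+1.
Proof. by apply/negP=> H; have := Ianti H; rewrite Isym H. Qed.

Lemma Idist_step i d : I i.+1 (i.+1 + d) -> ~~ I i (i + d.+2).
Proof. by rewrite Isym => /Ianti; rewrite Isym addSn !addnS. Qed.

Lemma Idist2 i : ~~ I i i.+2.
Proof. by have := @Idist_step i 0; rewrite addn0 addn2; apply. Qed.

Lemma Idist_nn i d : ~~ I i (i + d) -> ~~ I i (i + d.+1) -> I i (i + d.+2).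
Proof.
rewrite !addnS => n0 n1; apply/negPn/negP=> n2.
exact: (IK4 n0 n1 n2 (Idist1 _) (Idist2 _) (Idist1 _)).
Qed.

(** Induction on two consecutive distances. Only if [d] misses and [d.+1] meets is [d.+2] undecided;
    then missing at distance [d.+2] passes from [i] to [i.+1], hence all round the cycle. *)
Lemma Ihomogeneous d i : I i (i + d) = I 0 d.
Proof.
suff H : (forall i, I i (i + d) = I 0 d) /\ (forall i, I i (i + d.+1) = I 0 d.+1).
  by case: H.
elim: d {i} => [|d [IH1 IH2]].
  split=> i; rewrite ?addn0 ?Irefl // addn1.
  by rewrite (negPf (Idist1 i)) (negPf (Idist1 0)).
split=> // i; have [sd|nsd] := boolP (I 0 d).
  by rewrite !(negPf (@Idist_step _ _ _)) ?IH1 //; apply: (@Idist_step 0); rewrite IH1.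
have [sd1|nsd1] := boolP (I 0 d.+1); last first.
  by rewrite !Idist_nn ?IH1 ?IH2 //; apply: (@Idist_nn 0); rewrite ?IH1 ?IH2.
have n3 j : ~~ I j (j + d.+3) by apply: Idist_step; rewrite IH2.
have next j : ~~ I j (j + d.+2) -> ~~ I j.+1 (j.+1 + d.+2).
  move=> n2; have := Idist_nn n2 (n3 j); rewrite addnS => /Ianti.
  by rewrite addSnnS.
have nexts j m : ~~ I j (j + d.+2) -> ~~ I (j + m) (j + m + d.+2).
  by move=> nj; elim: m => [|m]; rewrite ?addn0 // [j + m.+1]addnS; apply: next.
have perm j m : I (j + m * r) (j + m * r + d.+2) = I j (j + d.+2).
  elim: m => [|m <-]; first by rewrite mul0n addn0.
  rewrite mulSn addnCA addnC Iper; set x := j + m * r.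
  by rewrite addnAC Isym Iper Isym.
apply: negb_inj; apply/idP/idP => H.
  (* After [i * r - i] more steps, [i] becomes [i * r], which stands for 0. *)
  have := nexts i (i * r - i) H; rewrite subnKC ?leq_pmulr //.
  by have := perm 0 i; rewrite !add0n => ->.
by have := nexts 0 i H; rewrite add0n.
Qed.

Theorem pattern_not_pow2 n : r <> 2 ^ n.+2.
Proof.
move=> rE; apply: (@no_dihedral_pow2 (I 0) _ _ _ _ _ n); rewrite -?rE.
- exact: Irefl.
- exact: Idist1.
- by move=> d sd; apply: (@Idist_step 0); rewrite Ihomogeneous.
- by move=> d; apply: (@Idist_nn 0).
- move=> x y z; rewrite -(Ihomogeneous y x) -(Ihomogeneous z (x + y)) -(Ihomogeneous (y + z) x) addnA.
  by move=> h1 h2 h3 h4 h5 h6; apply: (IK4 h1 h2 h3 h4 h6 h5).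
split=> [d|d dr]; first by rewrite Isym Iper Isym.
by rewrite -(Ihomogeneous d (r - d)) subnK // -[r in RHS]add0n Isym [RHS]Isym Iper Isym.
Qed.

End IntersectionPattern.

(** * Girth, colourings and a drawing of the directed cycle *)

Section DirectedCycle.
Variable r : nat.
Hypothesis r3 : 2 < r.

Definition dicycle : rel 'I_r := fun i j => j == i.+1 %% r :> nat.

Lemma dicycleP (i j : 'I_r) : dicycle i j -> (i.+1 < r /\ j = i.+1 :> nat) \/ (i.+1 = r /\ j = 0 :> nat).
Proof.
rewrite /dicycle => /eqP ->; have := ltn_ord i; rewrite leq_eqVlt => /predU1P[->|ir].
  by right; rewrite modnn.
by left; rewrite modn_small.
Qed.

Lemma dicycle_inj i j j' : dicycle i j -> dicycle i j' -> j = j'.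
Proof. by rewrite /dicycle => /eqP ij /eqP ij'; apply: val_inj; rewrite /= ij ij'. Qed.

Lemma dicycle_oriented : oriented dicycle.
Proof.
split=> [x|x y axy]; apply/negP.
  by case/dicycleP; lia.
by case/dicycleP; case/dicycleP: axy; lia.
Qed.

(** A vertex has two distinct neighbours on a cycle but only one predecessor, so the cycle is closed
    under successors and contains every vertex. *)
Lemma dicycle_girth : girth_ge dicycle r.
Proof.
move=> s us s3 cs.
have succ (x y : 'I_r) : x \in s -> dicycle x y -> y \in s.
  move=> xs xy; have [i p rp] := rot_to xs.
  have us' : uniq (x :: p) by rewrite -rp rot_uniq.
  have cs' : cycle (uadj dicycle) (x :: p) by rewrite -rp rot_cycle.
  have sp : 1 < size p by have := size_rot i s; rewrite rp /= => E; rewrite -E in s3.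
  have ps z : z \in p -> z \in s by move=> zp; rewrite -(mem_rot i) rp inE zp orbT.
  case: p us' cs' sp ps {rp} => // u p us' cs' sp ps.
  case/lastP: p us' cs' sp ps => // p v us' cs' _ ps.
  have uv : u != v by move: us'; rewrite /= mem_rcons inE negb_or => /and3P[_ /andP[]].
  move: cs'; rewrite /= rcons_path last_rcons => /and3P[xu _ vx].
  have nb w : uadj dicycle x w -> w = y \/ dicycle w x.
    rewrite /uadj => /orP[xw|]; [left|by right].
    exact: dicycle_inj xw xy.
  have pred1 w w' : dicycle w x -> dicycle w' x -> w = w'.
    by move=> /dicycleP h /dicycleP h'; apply/val_inj => /=; clear -h h'; lia.
  case: (nb u xu) => [<-|ux]; first by apply: ps; rewrite inE eqxx.
  case: (nb v) => [|<-|vx']; first by rewrite /uadj orbC.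
    by apply: ps; rewrite inE mem_rcons inE eqxx orbT.
  by rewrite (pred1 u v) ?eqxx in uv.
have r0 : 0 < r by apply: ltn_trans r3.
have [x0 x0s] : exists x, x \in s by case: (s) s3 => // x s'; exists x; rewrite inE eqxx.
have all i : Ordinal (ltn_pmod (x0 + i) r0) \in s.
  elim: i => [|i IH].
    by suff -> : Ordinal (ltn_pmod (x0 + 0) r0) = x0; last by apply: val_inj; rewrite /= addn0 modn_small.
  by apply: succ IH _; rewrite /dicycle /= addnS -[X in _ == X %% _]addn1 modnDml addn1.
rewrite -[X in X <= _]card_ord cardE; apply: uniq_leq_size (enum_uniq _) _ => v _.
(* Adding [r] first keeps the subtraction of [x0] from being truncated. *)
suff E : Ordinal (ltn_pmod (x0 + (v + r - x0)) r0) = v by have := all (v + r - x0); rewrite E.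
apply: val_inj => /=.
by rewrite subnKC ?modnDr ?modn_small // ltnW // ltn_addl.
Qed.

Lemma dicycle_not_colorable n b k : r = 2 ^ n.+2 -> 0 < b -> bfold_colorable dicycle b k ->
  4 * b <= k.
Proof.
move=> rE b0 [f [fb [fd fo]]]; rewrite leqNgt; apply/negP=> kb.
have r0 : 0 < r by apply: ltn_trans r3.
pose v i : 'I_r := Ordinal (ltn_pmod i r0).
pose I i j := f (v i) :&: f (v j) != finset.set0.
have vS i : dicycle (v i) (v i.+1) by rewrite /dicycle /= -[X in _ == X %% _]addn1 modnDml addn1.
apply: (@pattern_not_pow2 r I r0 _ _ _ _ _ n rE).
- by move=> i; rewrite /I finset.setIid -card_gt0 fb.
- by move=> i j; rewrite /I finset.setIC.
- by move=> i j; rewrite /I (_ : v (i + r) = v i) //; apply: val_inj; rewrite /= modnDr.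
- by move=> i j H; rewrite negbK; apply/eqP; apply: fo H.
move=> i j l m; rewrite !negbK.
have disj A B (C : {set 'I_k}) : A :&: B == finset.set0 -> A :&: C == finset.set0 ->
    A :&: (B :|: C) == finset.set0.
  by move=> /eqP h1 /eqP h2; rewrite finset.setIUr h1 h2 finset.setU0.
move=> ij il im jl jm lm.
have := subset_leq_card (finset.subsetT (f (v i) :|: (f (v j) :|: (f (v l) :|: f (v m))))).
rewrite !cardsU (eqP lm) (eqP (disj _ _ _ jl jm)) (eqP (disj _ _ _ ij (disj _ _ _ il im))).
by rewrite !cards0 !fb cardsT card_ord; lia.
Qed.

Section Drawing.
Local Open Scope ring_scope.
Local Open Scope classical_set_scope.
Import numFieldNormedType.Exports.

Lemma continuous_arc (R : realType) (a b e : R) :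
  continuous (fun t : R => (a + t * b, e * (t * (1 - t)))).
Proof.
move=> t; have cf : (a + x * b) @[x --> t] --> a + t * b.
  apply: cvgD; first exact: cvg_cst.
  by apply: cvgM; [exact: cvg_id|exact: cvg_cst].
have cg : (e * (x * (1 - x))) @[x --> t] --> e * (t * (1 - t)).
  apply: cvgM; first exact: cvg_cst.
  by apply: cvgM; [exact: cvg_id|apply: cvgB; [exact: cvg_cst|exact: cvg_id]].
exact: (cvg_pair cf cg).
Qed.

(** Vertices sit at integer points of the horizontal axis; arcs are unit segments, except the
    closing one, a parabola above the axis. *)
Lemma dicycle_planar : planar dicycle.
Proof.
pose pos (i : 'I_r) : Rline * Rline := (i%:R, 0).
pose c (i j : 'I_r) (t : Rline) : Rline * Rline :=
  (i%:R + t * (j%:R - i%:R), (i.+1 == r)%:R * (t * (1 - t))).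
have flat i j t : dicycle i j -> i.+1 != r -> c i j t = (i%:R + t, 0).
  by move=> /dicycleP[[_ E]|[->]]; rewrite ?eqxx // /c => /negPf->; rewrite E -natr1 addrAC subrr add0r mulr1 mul0r.
have arc (i j : 'I_r) (t : Rline) : i.+1 == r -> 0 < t < 1 -> 0 < (c i j t).2.
  by move=> ir /andP[t0 t1]; rewrite /c /= ir mul1r mulr_gt0 ?subr_gt0.
have nat_gap (a b : nat) (t : Rline) : 0 < t < 1 -> a%:R + t <> b%:R :> Rline.
  move=> /andP[t0 t1] E; have : (a < b < a.+1)%N.
    by rewrite -!(ltr_nat Rline) -E -natr1 ltrDl ltrD2l t0.
  by rewrite ltnS; case: ltngtP.
exists pos, c; split; first by move=> i j [] /eqP; rewrite eqr_nat => /eqP /val_inj.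
split=> [x y xy|x y z w xy zw ne t s tI sI E].
  split.
    exact/continuous_subspaceT/continuous_arc.
  split.
    move=> s t _ _ [/addrI E _]; apply: mulIf E; rewrite subr_eq0 eqr_nat.
    by case/dicycleP: xy; lia.
  split; first by rewrite /c !mul0r mulr0 addr0.
  split; first by rewrite /c mul1r subrr !mulr0 addrC subrK.
  move=> t v tI; have [xr|xr] := boolP (x.+1 == r).
    by move=> E; have := arc x y t xr tI; rewrite E ltxx.
  by rewrite flat // => -[]; apply: nat_gap.
have [xr|xr] := boolP (x.+1 == r); have [zr|zr] := boolP (z.+1 == r).
- apply: ne; have xz : x = z by apply/val_inj/succn_inj; rewrite /= (eqP xr) (eqP zr).
  by subst z; congr pair; apply: dicycle_inj xy zw.
- by have := arc x y t xr tI; rewrite E flat // ltxx.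
- by have := arc z w s zr sI; rewrite -E flat // ltxx.
move: E; rewrite !flat // => -[E].
have xz : x = z :> nat.
  case/andP: tI => t0 t1; case/andP: sI => s0 s1.
  apply/eqP; rewrite eqn_leq; apply/andP; split; rewrite -ltnS -(ltr_nat Rline) -natr1.
    by apply: (@lt_trans _ _ (x%:R + t)); rewrite ?ltrDl // E ltrD2l.
  by apply: (@lt_trans _ _ (z%:R + s)); rewrite ?ltrDl // -E ltrD2l.
apply: ne; have {}xz : x = z by apply/val_inj.
by subst z; congr pair; apply: dicycle_inj xy zw.
Qed.

End Drawing.

End DirectedCycle.

(** * Choice of the parameters *)

Theorem theorem6 : forall eps : Rline, (0 < eps)%R ->
  exists g : nat,
    (4%:E <= frac_oriented_chi_planar_girth g)%E /\
    (frac_oriented_chi_planar_girth g <= (4 + eps)%:E)%E.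
Proof.
move=> eps eps0.
(* For [b = n.+1] the ratio [(4 * b + 1) / b] is [4 + 1 / b], below [4 + eps]. *)
have /filter_ex[n Hn] := near_infty_natSinv_lt (PosNum eps0).
(* The 5 comes from K5. Since [m <= 2 ^ m], the required lower bound on [2 ^ k] can serve as [k];
   adding both girth requirements gives [g]. *)
pose b := n.+1; pose k := 2 ^ 5 * (3 * (4 * b)).
pose g := (6 * 5 ^ k).+1 + (4 * b + 2).
have b0 : (0 < b)%N by [].
exists g; split.
  (* The cycle length [2 ^ g.+2] is a power of 2 exceeding [g]. *)
  have r3 : (2 < 2 ^ g.+2)%N.
    by apply: (@leq_trans (2 ^ 2)); rewrite ?leq_exp2l.
  apply: le_trans (_ : frac_oriented_chi (@dicycle (2 ^ g.+2)) <= _)%E.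
    apply: le_ereal_inf_tmp => _ [c [l [c0 [col ->]]]].
    rewrite lee_fin ler_pdivlMr ?ltr0n // -natrM ler_nat.
    exact: (dicycle_not_colorable r3 erefl c0 col).
  apply: ereal_sup_ubound; exists 'I_(2 ^ g.+2), (@dicycle (2 ^ g.+2)); split=> //.
  split; first exact: dicycle_oriented.
  split; first exact: dicycle_planar.
  move=> s us s3 cs; apply: leq_trans (dicycle_girth r3 us s3 cs).
  exact: leq_trans (leqW (leqnSn g)) (ltnW (ltn_expl g.+2 (isT : 1 < 2)%N)).
apply: ge_ereal_sup => _ [V [a [[ora [pla gir]] ->]]].
have [phi ok] : exists phi : V -> nat, forall x y, a x y -> step b (phi x) (phi y).
  apply: (@high_girth_labelling V a ora b 5 k g) => //.
  - by apply/ltnW/ltn_expl.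
  - exact: leq_addr.
  - exact: leq_addl.
  - exact: planar_no_K5_minor.
apply: le_trans (_ : ((4 * b).+1%:R / b%:R : Rline)%:E <= _)%E.
  apply: ereal_inf_lbound; exists b, (4 * b).+1%N; split=> //; split=> //.
  exact: bfold_of_labelling ok.
rewrite lee_fin -natr1 natrM mulrDl mulfK ?pnatr_eq0 // lerD2l mul1r ltW //.
Qed.
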